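(* Let $0<\lambda<1/e$, $E(z)=\lambda e^z$, and let $s>1$. Let $h(t)=t/(\log(1/t))^s$ (defined for small $t>0$). Then $\mathcal H^h(\mathcal J(E)\setminus\mathcal C)=0$.
   Context: For $0<\lambda<1/e$ the function $E(z)=\lambda e^z$ has two real fixed points $\alpha<1<\beta$, with $\alpha$ attracting and $\beta$ repelling. The Fatou set $\mathcal F(E)$ is the set of points where the iterates $E^n$ form a normal family, and the Julia set is $\mathcal J(E)=\mathbb C\setminus\mathcal F(E)$. By a theorem of Devaney and Krych, $\mathcal F(E)$ is the attracting basin of $\alpha$ and $\mathcal J(E)$ is a union of uncountably many pairwise disjoint curves (''hairs''), each connecting a point of $\mathbb C$ (the endpoint of the hair) with $\infty$; each hair is the set of points of $\mathcal J(E)$ sharing a given itinerary, where the itinerary of $z$ is the sequence $(s_j)$ with $(2s_j-1)\pi\le \operatorname{Im}E^j(z)<(2s_j+1)\pi$. $\mathcal C$ denotes the set of endpoints of these hairs. For a gauge function $h$ (an increasing continuous $h:(0,t_0)\to(0,\infty)$ with $h(t)\to0$ as $t\to0$) and $A\subset\mathbb R^m$, $\mathcal H^h(A)=\lim_{\delta\to0}\inf\{\sum_k h(\operatorname{diam}A_k)\}$, the infimum over all countable covers $(A_k)$ of $A$ with $\operatorname{diam}A_k<\delta$. *)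

(* Defs.v *)
From Stdlib Require Import Reals.
Open Scope R_scope.

Definition C : Type := (R * R)%type.
Definition Re (z : C) : R := fst z.
Definition Im (z : C) : R := snd z.
Definition cabs (z : C) : R := sqrt (Re z * Re z + Im z * Im z).
Definition cdist (z w : C) : R := cabs (Re z - Re w, Im z - Im w).

Definition E (lam : R) (z : C) : C :=
  (lam * exp (Re z) * cos (Im z), lam * exp (Re z) * sin (Im z)).

Definition Eiter (lam : R) (n : nat) (z : C) : C := Nat.iter n (E lam) z.

(* Riemann sphere C ∪ {∞} as option C (None = ∞) with the chordal metric *)
Definition chordal (a b : option C) : R :=
  match a, b with
  | Some z, Some w => 2 * cdist z w / sqrt ((1 + cabs z ^ 2) * (1 + cabs w ^ 2))
  | Some z, None | None, Some z => 2 / sqrt (1 + cabs z ^ 2)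
  | None, None => 0
  end.

Definition strictly_incr (phi : nat -> nat) : Prop :=
  forall n m, (n < m)%nat -> (phi n < phi m)%nat.

(* The iterates (E^n) form a normal family on a neighbourhood of z0:
   every sequence E^(phi k) (phi strictly increasing) has a subsequence
   converging locally uniformly (in the chordal metric, limit possibly ∞)
   on the disk D(z0, r). Local uniformity = uniformity on each closed
   disk of radius rho < r. *)
Definition normal_at (lam : R) (z0 : C) : Prop :=
  exists r, 0 < r /\
    forall phi : nat -> nat, strictly_incr phi ->
      exists (psi : nat -> nat) (g : C -> option C), strictly_incr psi /\
        forall rho eps, 0 < rho -> rho < r -> 0 < eps ->
          exists N, forall k z, (N <= k)%nat -> cdist z z0 <= rho ->
            chordal (Some (Eiter lam (phi (psi k)) z)) (g z) < eps.

Definition Fatou (lam : R) (z : C) : Prop := normal_at lam z.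
Definition Julia (lam : R) (z : C) : Prop := ~ Fatou lam z.

Definition itinerary (lam : R) (z : C) (s : nat -> Z) : Prop :=
  forall j : nat,
    (2 * IZR (s j) - 1) * PI <= Im (Eiter lam j z) /\
    Im (Eiter lam j z) < (2 * IZR (s j) + 1) * PI.

Definition hair (lam : R) (z w : C) : Prop :=
  Julia lam w /\ exists s, itinerary lam z s /\ itinerary lam w s.

Definition endpoint (lam : R) (z : C) : Prop :=
  Julia lam z /\
  exists gamma : R -> C,
    gamma 0 = z /\
    (forall t eps, 0 <= t -> 0 < eps -> exists del, 0 < del /\
       forall u, 0 <= u -> Rabs (u - t) < del -> cdist (gamma u) (gamma t) < eps) /\
    (forall t u, 0 <= t -> 0 <= u -> gamma t = gamma u -> t = u) /\
    (forall M, exists T, forall t, T <= t -> M < cabs (gamma t)) /\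
    (forall w, hair lam z w <-> exists t, 0 <= t /\ gamma t = w).

Definition hgauge (s t : R) : R :=
  if Rle_dec t 0 then 0 else t / Rpower (ln (/ t)) s.

(* H^h(A) = 0: for every delta in (0,1) and eps > 0 there is a countable
   cover (A_k) of A with diam A_k <= d_k < delta and sum_k h(d_k) <= eps.
   (d_k are upper bounds for the diameters; since h is increasing this is
   equivalent to using the diameters themselves.) *)
Definition Hnull (h : R -> R) (A : C -> Prop) : Prop :=
  forall delta eps, 0 < delta -> delta < 1 -> 0 < eps ->
    exists (Ak : nat -> C -> Prop) (d : nat -> R),
      (forall k, 0 <= d k /\ d k < delta) /\
      (forall k z w, Ak k z -> Ak k w -> cdist z w <= d k) /\
      (forall z, A z -> exists k, Ak k z) /\
      (forall N, sum_f_R0 (fun k => h (d k)) N <= eps).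

(* Main.v *)
(* Let a < 1 < b be the fixed points of E.  The Julia set is K = {z | Re E^n(z) >= b for all n}:
   elsewhere the orbit is attracted to a uniformly near z, and for z in K the derivatives of E^n
   blow up.  On the right half-plane Re >= b the inverse branches of E contract by 1/b, so each
   hair above a given z is the uniform limit of pull-backs of horizontal rays, and z is an endpoint
   unless some c with the same itinerary satisfies Re E^n(z) - Re E^n(c) -> infinity.  In that case
   |Im E^(n+1)(z)| is about |E^(n+1)(c)|, which is eventually at most exp (Re E^n(z) / 2).

   Points with this last property for all n are covered as follows.  The image of a unit box with
   real part about m meets the allowed region in a rectangle of sides about u^2 and u, where
   u = exp (m/2).  Splitting it into unit boxes gives about u^3 boxes with real part about u^2, pulled
   back with factor u^(-2), and the factor 1/m' ~ u^(-2) in the bound const/m' for the weight of a box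
   at m' more than compensates for their number.  In the last generation squares of side u are
   used: about u of them, of pulled-back diameter about 1/u, so the logarithm in the gauge yields
   the factor 1/m. *)
From Stdlib Require Import Reals Lra Lia Psatz ZArith Classical IndefiniteDescription List Cantor.
Require Import Defs.
Open Scope R_scope.

(** The exponent [s] enters only through the comparison with [log_gauge], that is d / ln (1/d). This
    gauge suits the recursion because a contraction by X divides it by at least X. With X = lam u^2
    / 2, at most 20 u^3 boxes of weight const/X, pulled back by X, add up to const/u, far below 1/m
    once m exceeds a threshold of order 1/lam^2. Hence every generation halves both the diameters
    and the total weight, and all covers stay finite. [endpoint] asks for a parametrization of the
    whole hair, while a non-endpoint is given only negatively. Therefore a curve is built from every
    base point z of the Julia set. It always runs inside the hair and hits each w whose orbit
    eventually stays to the right of the orbit of z; a point that is never overtaken in this way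
    must come from a companion on the left. The orbit bounds hold only from some time on. Preimages
    under iterates are split by strips, on each of which E is injective and, where Re E >= 1, does
    not contract; this leaves a countable union. *)

(** * Modulus and distance in the plane *)

Lemma cabs_sqr (z : C) : cabs z * cabs z = Re z * Re z + Im z * Im z.
Proof. unfold cabs. apply sqrt_sqrt. nra. Qed.

Lemma cabs_nonneg (z : C) : 0 <= cabs z.
Proof. apply sqrt_pos. Qed.

Lemma Rabs_Re_le_cabs (z : C) : Rabs (Re z) <= cabs z.
Proof.
  apply Rsqr_incr_0_var; [|apply cabs_nonneg].
  unfold Rsqr. rewrite cabs_sqr, <- Rabs_mult, Rabs_right; nra.
Qed.

Lemma Rabs_Im_le_cabs (z : C) : Rabs (Im z) <= cabs z.
Proof.
  apply Rsqr_incr_0_var; [|apply cabs_nonneg].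
  unfold Rsqr. rewrite cabs_sqr, <- Rabs_mult, Rabs_right; nra.
Qed.

Lemma Re_le_cabs (z : C) : Re z <= cabs z.
Proof. eapply Rle_trans; [apply Rle_abs | apply Rabs_Re_le_cabs]. Qed.

Lemma cabs_le_sum (z : C) : cabs z <= Rabs (Re z) + Rabs (Im z).
Proof.
  pose proof (Rabs_pos (Re z)); pose proof (Rabs_pos (Im z)).
  apply Rsqr_incr_0_var; [|lra].
  unfold Rsqr. rewrite cabs_sqr.
  assert (Re z * Re z = Rabs (Re z) * Rabs (Re z)) by (rewrite <- Rabs_mult, Rabs_right; nra).
  assert (Im z * Im z = Rabs (Im z) * Rabs (Im z)) by (rewrite <- Rabs_mult, Rabs_right; nra).
  nra.
Qed.

Lemma cabs_le (z : C) (r : R) : 0 <= r -> Re z * Re z + Im z * Im z <= r * r -> cabs z <= r.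
Proof.
  intros Hr H. apply Rsqr_incr_0_var; [|easy]. unfold Rsqr. now rewrite cabs_sqr.
Qed.

Lemma le_cabs (z : C) (r : R) : r * r <= Re z * Re z + Im z * Im z -> r <= cabs z.
Proof.
  intros H. apply Rsqr_incr_0_var; [|apply cabs_nonneg]. unfold Rsqr. now rewrite cabs_sqr.
Qed.

Lemma cabs_add (z w : C) : cabs (Re z + Re w, Im z + Im w) <= cabs z + cabs w.
Proof.
  pose proof (cabs_nonneg z); pose proof (cabs_nonneg w).
  apply cabs_le; [lra|]. cbn [Re Im fst snd].
  pose proof (cabs_sqr z); pose proof (cabs_sqr w).
  (* Cauchy-Schwarz: the squares of the two sides differ by (Re z Im w - Im z Re w)^2. *)
  assert (Re z * Re w + Im z * Im w <= cabs z * cabs w).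
  { apply Rsqr_incr_0_var; [|nra]. unfold Rsqr.
    replace (cabs z * cabs w * (cabs z * cabs w))
      with ((cabs z * cabs z) * (cabs w * cabs w)) by ring.
    rewrite H1, H2. pose proof (Rle_0_sqr (Re z * Im w - Im z * Re w)).
    unfold Rsqr in *. nra. }
  nra.
Qed.

Lemma cdist_nonneg (z w : C) : 0 <= cdist z w.
Proof. apply cabs_nonneg. Qed.

Lemma cdist_sym (z w : C) : cdist z w = cdist w z.
Proof. unfold cdist, cabs. f_equal. cbn. ring. Qed.

Lemma cdist_refl (z : C) : cdist z z = 0.
Proof.
  unfold cdist, cabs. cbn. rewrite !Rminus_diag, Rmult_0_l, Rplus_0_l. apply sqrt_0.
Qed.

Lemma cdist_triangle (x y z : C) : cdist x z <= cdist x y + cdist y z.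
Proof.
  unfold cdist.
  replace (Re x - Re z, Im x - Im z)
    with (Re (Re x - Re y, Im x - Im y) + Re (Re y - Re z, Im y - Im z),
          Im (Re x - Re y, Im x - Im y) + Im (Re y - Re z, Im y - Im z)).
  - apply cabs_add.
  - cbn. f_equal; ring.
Qed.

Lemma cdist_sqr (z w : C) : cdist z w * cdist z w =
  (Re z - Re w) * (Re z - Re w) + (Im z - Im w) * (Im z - Im w).
Proof. unfold cdist. now rewrite cabs_sqr. Qed.

Lemma Rabs_Re_le_cdist (z w : C) : Rabs (Re z - Re w) <= cdist z w.
Proof. exact (Rabs_Re_le_cabs (Re z - Re w, Im z - Im w)). Qed.

Lemma Rabs_Im_le_cdist (z w : C) : Rabs (Im z - Im w) <= cdist z w.
Proof. exact (Rabs_Im_le_cabs (Re z - Re w, Im z - Im w)). Qed.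

Lemma cdist_le_sum (z w : C) : cdist z w <= Rabs (Re z - Re w) + Rabs (Im z - Im w).
Proof. exact (cabs_le_sum (Re z - Re w, Im z - Im w)). Qed.

Lemma cdist_le0_eq (z w : C) : cdist z w <= 0 -> z = w.
Proof.
  intros H. pose proof (Rabs_Re_le_cdist z w) as H1. pose proof (Rabs_Im_le_cdist z w) as H2.
  destruct z as [x y], w as [x' y']. cbn in *.
  f_equal; unfold Rabs in *; destruct (Rcase_abs (x - x')), (Rcase_abs (y - y')); lra.
Qed.

Lemma cabs_cdist (z w : C) : cabs z <= cabs w + cdist z w.
Proof.
  pose proof (cabs_add w (Re z - Re w, Im z - Im w)) as H. cbn [Re Im fst snd] in H.
  replace (Re w + (Re z - Re w), Im w + (Im z - Im w)) with z in H.
  - exact H.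
  - destruct z; cbn; f_equal; ring.
Qed.

(** * Elementary inequalities for the distance between two images *)

(** The inequality x <= tan x without its denominator; it converts the angular part of an image
    distance into a difference of imaginary parts. *)
Lemma tan_ge_id (x : R) : 0 <= x -> x < PI / 2 -> x * cos x <= sin x.
Proof.
  intros H0 H1. pose proof PI_RGT_0.
  destruct (Req_dec x 0) as [->|Hn]; [rewrite sin_0; lra|].
  destruct (MVT_cor2 (fun u => sin u - u * cos u) (fun u => u * sin u) 0 x) as (c & Hc & Hc').
  - lra.
  - intros c Hc.
    replace (c * sin c) with (cos c - (1 * cos c + c * (- sin c))) by ring.
    apply derivable_pt_lim_minus; [apply derivable_pt_lim_sin|].
    apply (derivable_pt_lim_mult (fun u => u) cos);
      [apply derivable_pt_lim_id | apply derivable_pt_lim_cos].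
  - cbv beta in Hc. rewrite sin_0 in Hc.
    pose proof (sin_gt_0 c ltac:(lra) ltac:(lra)).
    pose proof (Rmult_lt_0_compat _ _ (proj1 Hc') H2). nra.
Qed.

Lemma sinh_ge_id (v : R) : 0 <= v -> 2 * v <= exp v - exp (- v).
Proof.
  intros H0. destruct (Req_dec v 0) as [->|Hn]; [rewrite Ropp_0; lra|].
  destruct (MVT_cor2 (fun u => exp u - exp (- u)) (fun u => exp u + exp (- u)) 0 v)
    as (c & Hc & Hc').
  - lra.
  - intros c Hc.
    replace (exp c + exp (- c)) with (exp c - exp (- c) * (- 1)) by ring.
    apply derivable_pt_lim_minus; [apply derivable_pt_lim_exp|].
    apply (derivable_pt_lim_comp (fun u => - u) exp); [|apply derivable_pt_lim_exp].
    apply (derivable_pt_lim_opp (fun u => u)). apply derivable_pt_lim_id.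
  - cbv beta in Hc. rewrite Ropp_0, exp_0 in Hc.
    assert (exp c * exp (- c) = 1) by (rewrite <- exp_plus, Rplus_opp_r; apply exp_0).
    pose proof (exp_pos c); pose proof (exp_pos (- c)).
    assert (2 <= exp c + exp (- c)).
    { apply (Rmult_le_reg_l (exp c)); [easy|]. pose proof (Rle_0_sqr (exp c - 1)). unfold Rsqr in *. nra. }
    nra.
Qed.

(** With midpoint m and half-difference v, exp x - exp x' = 2 exp m sinh v, and sinh v >= v for v >=
    0. *)
Lemma exp_diff_sqr (x x' : R) :
  exp (x + x') * ((x - x') * (x - x')) <= (exp x - exp x') * (exp x - exp x').
Proof.
  assert (H : forall x x', x' <= x ->
    exp (x + x') * ((x - x') * (x - x')) <= (exp x - exp x') * (exp x - exp x')).
  { clear. intros x x' Hle. set (v := (x - x') / 2). set (m := (x + x') / 2).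
    replace x with (m + v) by (unfold m, v; field).
    replace x' with (m + - v) by (unfold m, v; field).
    assert (Hv : 0 <= v) by (unfold v; lra).
    replace (m + v + (m + - v)) with (m + m) by ring.
    rewrite !exp_plus. pose proof (sinh_ge_id v Hv) as Hs. pose proof (exp_pos m).
    replace ((exp m * exp v - exp m * exp (- v)) * (exp m * exp v - exp m * exp (- v)))
      with (exp m * exp m * ((exp v - exp (-v)) * (exp v - exp (-v)))) by ring.
    apply Rmult_le_compat_l; [nra|]. nra. }
  destruct (Rle_dec x' x); [now apply H|].
  rewrite Rplus_comm.
  replace ((x - x') * (x - x')) with ((x' - x) * (x' - x)) by ring.
  replace ((exp x - exp x') * (exp x - exp x')) with ((exp x' - exp x) * (exp x' - exp x)) by ring.
  apply H; lra.
Qed.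

(** The law of cosines with 1 - cos written as 2 sin^2 of the half angle, which separates radial
    from angular displacement. *)
Lemma cdist_polar_sqr (r r' y y' : R) :
  (r * cos y - r' * cos y') * (r * cos y - r' * cos y') +
  (r * sin y - r' * sin y') * (r * sin y - r' * sin y') =
  (r - r') * (r - r') + 4 * (r * r') * (sin ((y - y') / 2) * sin ((y - y') / 2)).
Proof.
  assert (H1 : cos (y - y') = 1 - 2 * (sin ((y - y') / 2) * sin ((y - y') / 2))).
  { replace (y - y') with (2 * ((y - y') / 2)) at 1 by field. rewrite cos_2a_sin. ring. }
  rewrite cos_minus in H1.
  pose proof (sin2_cos2 y) as H2; pose proof (sin2_cos2 y') as H3. unfold Rsqr in *.
  transitivity (r * r * (sin y * sin y + cos y * cos y) + r' * r' * (sin y' * sin y' + cos y' * cos y')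
     - 2 * (r * r') * (cos y * cos y' + sin y * sin y')); [ring|].
  rewrite H1, H2, H3. ring.
Qed.

(** ** Strips and the inverse branches of E *)

(** The itinerary entry as a function: shift by PI and floor reproduce the half-open strips of
    [itinerary]. *)
Definition strip (z : C) : Z := Int_part ((Im z + PI) / (2 * PI)).

Lemma strip_spec (z : C) :
  (2 * IZR (strip z) - 1) * PI <= Im z /\ Im z < (2 * IZR (strip z) + 1) * PI.
Proof.
  unfold strip. set (q := (Im z + PI) / (2 * PI)).
  destruct (base_Int_part q) as [H1 H2]. pose proof PI_RGT_0.
  assert (Hq : Im z = q * (2 * PI) - PI) by (unfold q; field; lra).
  split; nra.
Qed.

Lemma strip_unique (z : C) (k : Z) :
  (2 * IZR k - 1) * PI <= Im z -> Im z < (2 * IZR k + 1) * PI -> strip z = k.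
Proof.
  intros H1 H2. destruct (strip_spec z) as [H3 H4]. pose proof PI_RGT_0.
  assert (IZR k < IZR (strip z + 1)) by (rewrite plus_IZR; nra).
  assert (IZR (strip z) < IZR (k + 1)) by (rewrite plus_IZR; nra).
  apply lt_IZR in H0, H5. lia.
Qed.

Lemma cos_sin_period_Z (x : R) (k : Z) :
  cos (x + 2 * IZR k * PI) = cos x /\ sin (x + 2 * IZR k * PI) = sin x.
Proof.
  assert (H : forall x n, cos (x + 2 * IZR (Z.of_nat n) * PI) = cos x /\
                          sin (x + 2 * IZR (Z.of_nat n) * PI) = sin x).
  { intros y n. rewrite <- INR_IZR_INZ. split; [apply cos_period | apply sin_period]. }
  destruct (Z_le_gt_dec 0 k) as [Hk|Hk].
  - rewrite <- (Z2Nat.id k Hk). apply H.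
  - destruct (H (x + 2 * IZR k * PI) (Z.to_nat (- k))) as [H1 H2].
    rewrite Z2Nat.id in H1, H2 by lia. rewrite opp_IZR in H1, H2.
    replace (x + 2 * IZR k * PI + 2 * - IZR k * PI) with x in H1, H2 by ring.
    split; congruence.
Qed.

(** A positive cosine selects the middle half of a strip. Two such points of one strip therefore
    differ by less than PI in imaginary part. *)
Lemma strip_half (z : C) : 0 < cos (Im z) -> Rabs (Im z - 2 * IZR (strip z) * PI) < PI / 2.
Proof.
  intros H. destruct (strip_spec z) as [H1 H2]. set (k := strip z) in *.
  set (y := Im z - 2 * IZR k * PI). pose proof PI_RGT_0.
  replace (Im z) with (y + 2 * IZR k * PI) in H by (unfold y; ring).
  rewrite (proj1 (cos_sin_period_Z y k)) in H.
  apply Rabs_def1.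
  - apply Rnot_le_lt. intros Hy. pose proof (cos_le_0 y ltac:(lra) ltac:(unfold y; lra)). lra.
  - apply Rnot_le_lt. intros Hy. rewrite <- cos_neg in H.
    pose proof (cos_le_0 (- y) ltac:(lra) ltac:(unfold y; lra)). lra.
Qed.

Lemma cos_Im_pos (lam : R) (z : C) : 0 < lam -> 0 < Re (E lam z) -> 0 < cos (Im z).
Proof.
  intros Hl H. cbn in H. pose proof (exp_pos (Re z)). pose proof (Rmult_lt_0_compat _ _ Hl H0).
  apply (Rmult_lt_reg_l (lam * exp (Re z))); [easy|]. unfold Re, Im in *. lra.
Qed.

Lemma cabs_E (lam : R) (z : C) : 0 < lam -> cabs (E lam z) = lam * exp (Re z).
Proof.
  intros Hl. pose proof (exp_pos (Re z)). pose proof (Rmult_lt_0_compat _ _ Hl H).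
  unfold cabs, E. cbn [Re Im fst snd].
  pose proof (sin2_cos2 (Im z)) as Hs. unfold Rsqr in Hs.
  replace (lam * exp (Re z) * cos (Im z) * (lam * exp (Re z) * cos (Im z)) +
     lam * exp (Re z) * sin (Im z) * (lam * exp (Re z) * sin (Im z)))
   with ((lam * exp (Re z)) * (lam * exp (Re z)) * (sin (Im z) * sin (Im z) + cos (Im z) * cos (Im z))) by ring.
  rewrite Hs, Rmult_1_r. apply sqrt_square. lra.
Qed.

Lemma cdist_E_sqr (lam : R) (z w : C) : cdist (E lam z) (E lam w) * cdist (E lam z) (E lam w) =
  lam * lam * ((exp (Re z) - exp (Re w)) * (exp (Re z) - exp (Re w)) +
   4 * exp (Re z + Re w) * (sin ((Im z - Im w) / 2) * sin ((Im z - Im w) / 2))).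
Proof.
  rewrite cdist_sqr. unfold E. cbn [Re Im fst snd]. rewrite cdist_polar_sqr, exp_plus. ring.
Qed.

(* Since cos y cos y' <= cos^2 ((y - y')/2), the lower bound m on the real parts of the images
   gives a factor 1 / cos^2, so that the sine in [cdist_E_sqr] is replaced by a tangent. *)
Lemma E_expand (lam m : R) (z w : C) : 0 < lam -> 0 < m -> strip z = strip w ->
  m <= Re (E lam z) -> m <= Re (E lam w) -> m * cdist z w <= cdist (E lam z) (E lam w).
Proof.
  intros Hl Hm Hs Hz Hw.
  pose proof (strip_half z (cos_Im_pos lam z Hl ltac:(lra))) as Bz.
  pose proof (strip_half w (cos_Im_pos lam w Hl ltac:(lra))) as Bw.
  rewrite Hs in Bz. set (k := strip w) in *.
  apply Rabs_def2 in Bz, Bw.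
  apply Rsqr_incr_0_var; [|apply cdist_nonneg]. unfold Rsqr.
  rewrite cdist_E_sqr.
  replace (m * cdist z w * (m * cdist z w)) with (m * m * (cdist z w * cdist z w)) by ring.
  rewrite cdist_sqr.
  unfold E in Hz, Hw; cbn [Re fst] in Hz, Hw. fold (Re z) in Hz; fold (Re w) in Hw.
  set (x := Re z) in *; set (x' := Re w) in *; set (y := Im z) in *; set (y' := Im w) in *.
  set (c := cos ((y - y') / 2)). set (sn := sin ((y - y') / 2)).
  assert (Hc : cos y * cos y' <= c * c).
  { unfold c. assert (cos y * cos y' = (cos (y + y') + cos (y - y')) / 2).
    { rewrite cos_plus, cos_minus. field. }
    pose proof (COS_bound (y + y')).
    assert (cos (y - y') = 2 * (cos ((y - y') / 2) * cos ((y - y') / 2)) - 1).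
    { replace (y - y') with (2 * ((y - y') / 2)) at 1 by field. rewrite cos_2a_cos. ring. }
    lra. }
  assert (Ht : ((y - y') / 2) * ((y - y') / 2) * (c * c) <= sn * sn).
  { assert (Hpos : forall v, 0 <= v -> v < PI / 2 -> v * v * (cos v * cos v) <= sin v * sin v).
    { intros v V0 V1. pose proof (tan_ge_id v V0 V1). pose proof (cos_ge_0 v ltac:(lra) ltac:(lra)).
      assert (0 <= v * cos v) by nra. nra. }
    unfold c, sn. destruct (Rle_dec 0 ((y - y') / 2)).
    - apply Hpos; lra.
    - specialize (Hpos (- ((y - y') / 2)) ltac:(lra) ltac:(lra)).
      rewrite cos_neg, sin_neg in Hpos. lra. }
  pose proof (exp_diff_sqr x x') as He.
  assert (Hmm : m * m <= lam * lam * exp (x + x') * (cos y * cos y')).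
  { rewrite exp_plus. replace (lam * lam * (exp x * exp x') * (cos y * cos y'))
      with ((lam * exp x * cos y) * (lam * exp x' * cos y')) by ring.
    apply Rmult_le_compat; lra. }
  assert (Hll : 0 < lam * lam) by nra. pose proof (exp_pos (x + x')) as Hp.
  assert (Hle : m * m <= lam * lam * exp (x + x') * (c * c)).
  { eapply Rle_trans; [exact Hmm|]. apply Rmult_le_compat_l; [nra|easy]. }
  assert (Hc1 : c * c <= 1).
  { unfold c. pose proof (COS_bound ((y - y') / 2)). clear - H. nra. }
  assert (Hll2 : 0 < lam * lam * exp (x + x')) by nra.
  set (q := lam * lam * exp (x + x')) in *.
  assert (S1 : m * m * ((x - x') * (x - x')) <= lam * lam * ((exp x - exp x') * (exp x - exp x'))).
  { apply Rle_trans with (q * ((x - x') * (x - x'))).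
    - apply Rmult_le_compat_r; [apply Rle_0_sqr|]. apply Rle_trans with (1 := Hle).
      rewrite <- (Rmult_1_r q) at 2. apply Rmult_le_compat_l; lra.
    - unfold q. rewrite Rmult_assoc. apply Rmult_le_compat_l; lra. }
  assert (S2 : m * m * ((y - y') * (y - y')) <= q * (4 * (sn * sn))).
  { apply Rle_trans with (q * (c * c) * ((y - y') * (y - y'))).
    - apply Rmult_le_compat_r; [apply Rle_0_sqr|easy].
    - rewrite Rmult_assoc. apply Rmult_le_compat_l; [lra|]. lra. }
  unfold q in S2. lra.
Qed.

(** On the half-plane |E'| is at most lam exp M; the exact formula [cdist_E_sqr] with 2 |sin (v/2)|
    <= |v| takes the place of a complex mean value argument. *)
Lemma E_lipschitz (lam M : R) (z w : C) : 0 < lam -> Re z <= M -> Re w <= M ->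
  cdist (E lam z) (E lam w) <= lam * exp M * cdist z w.
Proof.
  intros Hl Hz Hw. pose proof (exp_pos M) as HM.
  assert (HlM : 0 < lam * exp M) by nra.
  apply Rsqr_incr_0_var; [|pose proof (cdist_nonneg z w); nra]. unfold Rsqr.
  rewrite cdist_E_sqr.
  replace (lam * exp M * cdist z w * (lam * exp M * cdist z w))
    with (lam * lam * (exp M * exp M * (cdist z w * cdist z w))) by ring.
  rewrite cdist_sqr. apply Rmult_le_compat_l; [nra|].
  set (x := Re z) in *; set (x' := Re w) in *. set (v := Im z - Im w).
  assert (H1 : (exp x - exp x') * (exp x - exp x') <= exp M * exp M * ((x - x') * (x - x'))).
  { assert (Hab : forall x x', x <= M -> x' <= x -> 0 <= exp x - exp x' <= exp M * (x - x')).
    { clear. intros x x' Hx Hx'. pose proof (exp_ineq1_le (x' - x)) as H.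
      assert (exp x' = exp x * exp (x' - x)) by (rewrite <- exp_plus; f_equal; ring).
      pose proof (exp_pos x).
      assert (exp x <= exp M) by (destruct Hx as [Hx|<-]; [left; now apply exp_increasing|lra]).
      assert (exp x' <= exp x) by (destruct Hx' as [Hx'|<-]; [left; now apply exp_increasing|lra]).
      split; [lra|]. apply Rle_trans with (exp x * (x - x')); [nra|].
      apply Rmult_le_compat_r; lra. }
    destruct (Rle_dec x' x).
    - pose proof (Hab x x' Hz ltac:(easy)). nra.
    - pose proof (Hab x' x Hw ltac:(lra)). nra. }
  assert (H2 : 4 * (sin (v / 2) * sin (v / 2)) <= v * v).
  { assert (Hs : Rabs (sin (v/2)) <= Rabs (v / 2)).
    { destruct (Rle_dec 0 (v/2)) as [H|H].
      - destruct (Req_dec (v/2) 0) as [->|Hn]; [rewrite sin_0; apply Rle_refl|].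
        pose proof (sin_lt_x (v/2) ltac:(lra)).
        destruct (Rle_dec (v/2) 1).
        + pose proof (sin_ge_0 (v/2) ltac:(lra) ltac:(pose proof PI_RGT_0; pose proof PI2_1; lra)).
          rewrite !Rabs_right; lra.
        + pose proof (SIN_bound (v/2)). rewrite (Rabs_right (v/2)) by lra. apply Rabs_le. lra.
      - rewrite <- (Rabs_Ropp (sin _)), <- (Rabs_Ropp (v/2)), <- sin_neg.
        pose proof (sin_lt_x (-(v/2)) ltac:(lra)).
        destruct (Rle_dec (-(v/2)) 1).
        + pose proof (sin_ge_0 (-(v/2)) ltac:(lra) ltac:(pose proof PI_RGT_0; pose proof PI2_1; lra)).
          rewrite !Rabs_right; lra.
        + pose proof (SIN_bound (-(v/2))). rewrite (Rabs_right (-(v/2))) by lra. apply Rabs_le. lra. }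
    apply Rsqr_le_abs_1 in Hs. unfold Rsqr in Hs. lra. }
  assert (H3 : exp (x + x') <= exp M * exp M).
  { rewrite <- exp_plus. destruct (Rle_lt_or_eq_dec (x + x') (M + M)) as [H| ->]; [lra| |lra].
    left; now apply exp_increasing. }
  pose proof (exp_pos (x + x')). fold v.
  assert (H4 : 4 * exp (x + x') * (sin (v / 2) * sin (v / 2)) <= exp M * exp M * (v * v)).
  { replace (4 * exp (x + x') * (sin (v / 2) * sin (v / 2)))
      with (exp (x + x') * (4 * (sin (v / 2) * sin (v / 2)))) by ring.
    apply Rmult_le_compat; nra. }
  lra.
Qed.

(** The inverse branch of E into strip k, meant for Re w > 0, where the arctangent is the argument
    of w. *)
Definition L (lam : R) (k : Z) (w : C) : C :=
  (ln (cabs w / lam), atan (Im w / Re w) + 2 * IZR k * PI).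

Lemma cabs_pos (w : C) : 0 < Re w -> 0 < cabs w.
Proof. intros H. pose proof (Re_le_cabs w). lra. Qed.

Lemma E_L (lam : R) (k : Z) (w : C) : 0 < lam -> 0 < Re w -> E lam (L lam k w) = w.
Proof.
  intros Hl Hw. pose proof (cabs_pos w Hw) as Hc.
  unfold E, L. cbn [Re Im fst snd].
  rewrite exp_ln by (now apply Rdiv_lt_0_compat).
  destruct (cos_sin_period_Z (atan (Im w / Re w)) k) as [-> ->].
  rewrite cos_atan, sin_atan.
  assert (Hs : sqrt (1 + (Im w / Re w)²) = cabs w / Re w).
  { apply sqrt_lem_1.
    - unfold Rsqr. nra.
    - left. now apply Rdiv_lt_0_compat.
    - unfold Rsqr. replace (cabs w / Re w * (cabs w / Re w)) with (cabs w * cabs w / (Re w * Re w)) by (field; lra).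
      rewrite cabs_sqr. field. lra. }
  rewrite Hs. destruct w as [x y]. cbn [Re Im fst snd] in *. f_equal; field; lra.
Qed.

Lemma strip_L (lam : R) (k : Z) (w : C) : strip (L lam k w) = k.
Proof.
  pose proof (atan_bound (Im w / Re w)). pose proof PI_RGT_0.
  apply strip_unique; unfold L; cbn [Im snd]; unfold Im, Re in *; nra.
Qed.

(** Both points lie in one strip and have the same image, so the expansion bound forces their
    distance to be 0. *)
Lemma L_E (lam : R) (z : C) : 0 < lam -> 0 < Re (E lam z) -> L lam (strip z) (E lam z) = z.
Proof.
  intros Hl Hz. apply cdist_le0_eq.
  pose proof (E_expand lam (Re (E lam z)) (L lam (strip z) (E lam z)) z Hl Hz) as H.
  rewrite strip_L, E_L, cdist_refl in H by easy.
  specialize (H eq_refl (Rle_refl _) (Rle_refl _)). nra.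
Qed.

Lemma L_lipschitz (lam m : R) (k : Z) (a b : C) : 0 < lam -> 0 < m -> m <= Re a -> m <= Re b ->
  m * cdist (L lam k a) (L lam k b) <= cdist a b.
Proof.
  intros Hl Hm Ha Hb.
  pose proof (E_expand lam m (L lam k a) (L lam k b) Hl Hm) as H.
  rewrite !strip_L, !E_L in H by lra. auto.
Qed.

Lemma ln_le_mono (x y : R) : 0 < x -> x <= y -> ln x <= ln y.
Proof. intros H [H1| ->]; [left; now apply ln_increasing | lra]. Qed.

Lemma exp_le_mono (x y : R) : x <= y -> exp x <= exp y.
Proof. intros [H1| ->]; [left; now apply exp_increasing | lra]. Qed.

(** Since |w| >= b and ln (b / lam) = b, every branch preserves the half-plane Re >= b; pull-backs
    never leave the region of contraction by 1/b. *)
Lemma Re_L_ge (lam b : R) (k : Z) (w : C) : 0 < lam -> lam * exp b = b -> b <= Re w ->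
  b <= Re (L lam k w).
Proof.
  intros Hl Hb Hw. pose proof (exp_pos b). assert (0 < b) by nra.
  unfold L. cbn [Re fst]. rewrite <- (ln_exp b) at 1. apply ln_le_mono; [easy|].
  apply (Rmult_le_reg_l lam); [easy|]. rewrite Hb.
  pose proof (Re_le_cabs w). replace (lam * (cabs w / lam)) with (cabs w) by (field; lra). lra.
Qed.

(** * Iterates, real fixed points and the attracting basin *)

Lemma Eiter_succ (lam : R) (n : nat) (z : C) : Eiter lam (S n) z = Eiter lam n (E lam z).
Proof. induction n as [|n IH]; [reflexivity|]. cbn in *. now rewrite IH. Qed.

Lemma Eiter_add (lam : R) (n m : nat) (z : C) : Eiter lam (n + m) z = Eiter lam n (Eiter lam m z).
Proof.
  induction n as [|n IH]; [reflexivity|].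
  change (E lam (Eiter lam (n + m) z) = E lam (Eiter lam n (Eiter lam m z))). now rewrite IH.
Qed.

Lemma lam_exp_1 (lam : R) : lam < exp (-1) -> lam * exp 1 < 1.
Proof.
  intros H1. apply (Rmult_lt_compat_r (exp 1)) in H1; [|apply exp_pos].
  rewrite <- exp_plus in H1. replace (-1 + 1) with 0 in H1 by ring. now rewrite exp_0 in H1.
Qed.

Lemma fixed_points (lam : R) : 0 < lam -> lam < exp (-1) ->
  exists a b, 0 < a /\ a < 1 /\ 1 < b /\ lam * exp a = a /\ lam * exp b = b.
Proof.
  intros H0 H1.
  pose proof (lam_exp_1 lam H1) as He.
  assert (Hc : continuity (fun x => x - lam * exp x)).
  { apply continuity_minus; [apply derivable_continuous, derivable_id|].
    apply continuity_scal. apply derivable_continuous, derivable_exp. }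
  destruct (IVT (fun x => x - lam * exp x) 0 1) as (a & Ha & Ha'); try assumption; try lra.
  { rewrite exp_0. lra. }
  (* Here lam exp B >= lam (1 + B/2)^2 > (lam B) B / 4 >= B because lam B >= 4, so the sign has
     changed at [B]. *)
  set (B := 4 / lam + 1).
  assert (HB : 4 / lam > 0) by (apply Rdiv_lt_0_compat; lra).
  destruct (IVT (fun x => - (x - lam * exp x)) 1 B) as (b & Hb & Hb').
  - now apply (continuity_opp (fun x => x - lam * exp x)).
  - unfold B. lra.
  - lra.
  - replace (exp B) with (exp (B / 2) * exp (B / 2)) by (rewrite <- exp_plus; f_equal; field).
    pose proof (exp_ineq1_le (B / 2)).
    assert (4 <= lam * B) by (unfold B; replace (lam * (4 / lam + 1)) with (4 + lam) by (field; lra); lra).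
    assert (0 < B) by (unfold B; lra).
    assert (lam * ((1 + B / 2) * (1 + B / 2)) <= lam * (exp (B / 2) * exp (B / 2)))
      by (apply Rmult_le_compat_l; [lra | apply Rmult_le_compat; lra]).
    nra.
  - exists a, b. cbv beta in *.
    assert (a <> 0) by (intros ->; rewrite exp_0 in Ha'; lra).
    assert (a <> 1) by (intros ->; lra). assert (b <> 1) by (intros ->; lra).
    repeat split; lra.
Qed.

Lemma INR_mult_unbounded (c M : R) : 0 < c -> exists n : nat, M < INR n * c.
Proof.
  intros Hc. destruct (INR_unbounded (M / c)) as [n Hn]. exists n.
  apply (Rmult_lt_compat_r c) in Hn; [|easy]. replace (M / c * c) with M in Hn by (field; lra). lra.
Qed.

Lemma inv_lt_1 (b : R) : 1 < b -> 0 < / b /\ / b < 1.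
Proof.
  intros H. split; [apply Rinv_0_lt_compat; lra|].
  rewrite <- Rinv_1. apply Rinv_lt_contravar; lra.
Qed.

Lemma pow_small (k C eps : R) : 0 <= k -> k < 1 -> 0 <= C -> 0 < eps ->
  exists N : nat, forall n, (N <= n)%nat -> C * k ^ n < eps.
Proof.
  intros H0 H1 HC He.
  destruct (pow_lt_1_zero k ltac:(rewrite Rabs_right; lra) (eps / (C + 1))) as [N HN].
  { apply Rdiv_lt_0_compat; lra. }
  exists N. intros n Hn. specialize (HN n Hn). pose proof (pow_le k n H0).
  rewrite Rabs_right in HN by lra.
  apply (Rmult_lt_compat_l (C + 1)) in HN; [|lra].
  replace ((C + 1) * (eps / (C + 1))) with eps in HN by (field; lra). nra.
Qed.

Lemma Eiter_continuous (lam : R) (n : nat) (z : C) (eps : R) : 0 < lam -> 0 < eps ->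
  exists del, 0 < del /\ forall w, cdist w z <= del -> cdist (Eiter lam n w) (Eiter lam n z) < eps.
Proof.
  intros Hl. revert eps. induction n as [|n IH]; intros eps He.
  { exists (eps / 2). split; [lra|]. intros w Hw. cbn. lra. }
  set (v := Eiter lam n z) in *. set (M := Re v + 1).
  pose proof (exp_pos M). assert (0 < lam * exp M) by nra.
  destruct (IH (Rmin 1 (eps / (lam * exp M)))) as (del & Hd & Hdel).
  { apply Rmin_glb_lt; [lra|]. now apply Rdiv_lt_0_compat. }
  exists del. split; [easy|]. intros w Hw. specialize (Hdel w Hw).
  change (cdist (E lam (Eiter lam n w)) (E lam v) < eps).
  pose proof (Rmin_l 1 (eps / (lam * exp M))). pose proof (Rmin_r 1 (eps / (lam * exp M))).
  pose proof (Rabs_Re_le_cdist (Eiter lam n w) v) as Hr. pose proof (Rle_abs (Re (Eiter lam n w) - Re v)).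
  eapply Rle_lt_trans; [apply (E_lipschitz lam M)|]; unfold M in *; try lra.
  replace eps with (lam * exp (Re v + 1) * (eps / (lam * exp (Re v + 1)))) by (field; lra).
  apply Rmult_lt_compat_l; lra.
Qed.

Lemma cabs_E_le (lam x : R) (z : C) : 0 < lam -> cabs z <= x -> cabs (E lam z) <= lam * exp x.
Proof.
  intros Hl Hz. rewrite cabs_E by easy. apply Rmult_le_compat_l; [lra|]. apply exp_le_mono.
  pose proof (Re_le_cabs z). lra.
Qed.

(** The number lam e < 1 bounds both |E| and the Lipschitz constant of E on the unit disk. *)
Lemma contract_unit_disk (lam a : R) (v : C) : 0 < lam -> lam < exp (-1) -> 0 < a -> a < 1 ->
  lam * exp a = a -> cabs v <= 1 ->
  forall j, cabs (Eiter lam j v) <= 1 /\ cdist (Eiter lam j v) (a, 0) <= 2 * (lam * exp 1) ^ j.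
Proof.
  intros Hl Hl1 Ha0 Ha1 Ha Hv. pose proof (lam_exp_1 lam Hl1) as He. pose proof (exp_pos 1).
  induction j as [|j [IH1 IH2]].
  - split; [easy|]. change (cdist v (a, 0) <= 2 * 1).
    unfold cdist. cbn [Re Im fst snd]. fold (Re v) (Im v).
    pose proof (cabs_add v (- a, 0)) as H1. cbn [Re Im fst snd] in H1. fold (Re v) (Im v) in H1.
    replace (Re v + - a, Im v + 0) with (Re v - a, Im v - 0) in H1 by (f_equal; ring).
    assert (cabs (- a, 0) <= 1). { apply cabs_le; [lra|]. cbn. clear - Ha0 Ha1. nra. } lra.
  - change (Eiter lam (S j) v) with (E lam (Eiter lam j v)).
    split; [pose proof (cabs_E_le lam 1 _ Hl IH1); lra|].
    assert (Hfix : E lam (a, 0) = (a, 0)).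
    { unfold E. cbn. rewrite cos_0, sin_0, Ha. f_equal; ring. }
    rewrite <- Hfix. cbn [pow].
    pose proof (E_lipschitz lam 1 (Eiter lam j v) (a, 0) Hl) as HE.
    pose proof (Re_le_cabs (Eiter lam j v)). cbn [Re fst] in HE.
    specialize (HE ltac:(lra) ltac:(lra)).
    apply Rle_trans with (1 := HE).
    assert (0 < lam * exp 1) by nra. nra.
Qed.

(** With u = b - x one has lam exp x = b exp (-u) <= b / (1 + u), and x (1 + u) - b = u (x - 1). The
    descent is thus at least u (x - 1) / (1 + u), bounded below on the whole interval. *)
Lemma real_descent (lam b u0 x : R) : 0 < lam -> lam * exp b = b -> 1 < b -> 1 < - ln lam ->
  0 < u0 -> - ln lam <= x -> x <= b - u0 ->
  lam * exp x <= x - u0 * (- ln lam - 1) / (1 + b).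
Proof.
  intros Hl Hb Hb1 HT Hu H1 H2. set (u := b - x).
  assert (Hx : lam * exp x * (1 + u) <= b).
  { replace x with (b + - u) by (unfold u; ring). rewrite exp_plus, <- Rmult_assoc, Hb.
    pose proof (exp_ineq1_le u). pose proof (exp_pos (- u)).
    assert (exp (- u) * exp u = 1) by (rewrite <- exp_plus, Rplus_opp_l; apply exp_0).
    assert (exp (- u) * (1 + u) <= 1) by nra. nra. }
  apply (Rmult_le_reg_r (1 + u)); [unfold u; lra|].
  apply Rle_trans with (1 := Hx).
  assert (u0 * (- ln lam - 1) / (1 + b) * (1 + u) <= u * (x - 1)).
  { apply Rle_trans with (u0 * (- ln lam - 1)).
    - replace (u0 * (- ln lam - 1) / (1 + b) * (1 + u))
        with (u0 * (- ln lam - 1) * ((1 + u) / (1 + b))) by (field; lra).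
      rewrite <- (Rmult_1_r (u0 * (- ln lam - 1))) at 2. apply Rmult_le_compat_l; [nra|].
      apply (Rmult_le_reg_r (1 + b)); [lra|]. unfold Rdiv. rewrite Rmult_assoc, Rinv_l by lra.
      unfold u. lra.
    - apply Rmult_le_compat; unfold u; lra. }
  unfold u in *. nra.
Qed.

(** Because |E v| <= lam exp |v|, the moduli are dominated by the real iteration, so the waiting
    time depends on [rho] only and not on v. *)
Lemma basin_attracted (lam a b rho eps : R) : 0 < lam -> lam < exp (-1) -> 0 < a -> a < 1 -> 1 < b ->
  lam * exp a = a -> lam * exp b = b -> rho < b -> 0 < eps ->
  exists N : nat, forall v k, cabs v <= rho -> (N <= k)%nat -> cdist (Eiter lam k v) (a, 0) < eps.
Proof.
  intros Hl Hl1 Ha0 Ha1 Hb1 Ha Hb Hr He.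
  (* [T] solves lam exp T = 1: a point of modulus at most [T] is sent into the unit disk. *)
  set (T := - ln lam).
  assert (HT : 1 < T).
  { unfold T. apply ln_increasing in Hl1; [|easy]. rewrite ln_exp in Hl1. lra. }
  set (u0 := b - rho). set (c := u0 * (T - 1) / (1 + b)).
  assert (Hc : 0 < c).
  { apply Rdiv_lt_0_compat; [|lra]. apply Rmult_lt_0_compat; unfold u0; lra. }
  destruct (INR_mult_unbounded c b Hc) as [K HK].
  pose proof (lam_exp_1 lam Hl1) as Hk. pose proof (exp_pos 1).
  destruct (pow_small (lam * exp 1) 2 eps) as [N HN]; try lra; [nra|].
  (* [K] steps of descent by [c] bring the modulus to [T], one more reaches the unit disk, and [N]
     contractions reach [eps]. *)
  exists (S K + N)%nat. intros v k Hv HkN.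
  assert (HT1 : lam * exp T = 1).
  { unfold T. rewrite exp_Ropp, exp_ln by easy. field. lra. }
  assert (Hdesc : forall j, cabs (Eiter lam j v) <= T \/ cabs (Eiter lam j v) <= rho - INR j * c).
  { induction j as [|j IH].
    - right. cbn. lra.
    - change (Eiter lam (S j) v) with (E lam (Eiter lam j v)).
      destruct (Rle_dec (cabs (Eiter lam j v)) T) as [H0|H0].
      + left. pose proof (cabs_E_le lam T _ Hl H0). lra.
      + destruct IH as [IH|IH]; [lra|]. right. rewrite S_INR.
        pose proof (pos_INR j).
        pose proof (real_descent lam b u0 (cabs (Eiter lam j v)) Hl Hb Hb1 HT) as HD.
        fold T c in HD.
        assert (lam * exp (cabs (Eiter lam j v)) <= cabs (Eiter lam j v) - c)
          by (apply HD; unfold u0; nra).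
        pose proof (cabs_E_le lam _ (Eiter lam j v) Hl (Rle_refl _)). lra. }
  assert (HK1 : cabs (Eiter lam (S K) v) <= 1).
  { rewrite <- HT1. change (Eiter lam (S K) v) with (E lam (Eiter lam K v)).
    apply cabs_E_le; [easy|]. destruct (Hdesc K) as [H0|H0]; [easy|].
    pose proof (cabs_nonneg (Eiter lam K v)). lra. }
  replace k with ((k - S K) + S K)%nat by lia. rewrite Eiter_add.
  destruct (contract_unit_disk lam a _ Hl Hl1 Ha0 Ha1 Ha HK1 (k - S K)) as [_ H2].
  apply Rle_lt_trans with (1 := H2). apply HN. lia.
Qed.

(** A real part below b says nothing about the modulus of E^n z, so one more iteration is taken:
    |E^(n+1) w| = lam exp (Re E^n w) stays below b, uniformly for w near z. *)
Lemma basin_uniform (lam a b : R) (n : nat) (z : C) :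
  0 < lam -> lam < exp (-1) -> 0 < a -> a < 1 -> 1 < b -> lam * exp a = a -> lam * exp b = b ->
  Re (Eiter lam n z) < b ->
  exists r, 0 < r /\ forall eps, 0 < eps -> exists N : nat, forall w k,
    cdist w z <= r -> (N <= k)%nat -> cdist (Eiter lam k w) (a, 0) < eps.
Proof.
  intros Hl Hl1 Ha0 Ha1 Hb1 Ha Hb Hn.
  set (x := (Re (Eiter lam n z) + b) / 2).
  destruct (Eiter_continuous lam n z ((b - Re (Eiter lam n z)) / 2) Hl ltac:(lra)) as (r & Hr & Hw).
  exists r. split; [easy|]. intros eps He.
  assert (Hx : lam * exp x < b).
  { rewrite <- Hb at 1. apply Rmult_lt_compat_l; [easy|]. apply exp_increasing. unfold x. lra. }
  destruct (basin_attracted lam a b (lam * exp x) eps) as [N HN]; try assumption.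
  exists (N + S n)%nat. intros w k Hwz Hk.
  replace k with ((k - S n) + S n)%nat by lia. rewrite Eiter_add. apply HN; [|lia].
  change (Eiter lam (S n) w) with (E lam (Eiter lam n w)). rewrite cabs_E by easy.
  apply Rmult_le_compat_l; [lra|]. apply exp_le_mono.
  pose proof (Rabs_Re_le_cdist (Eiter lam n w) (Eiter lam n z)).
  pose proof (Rle_abs (Re (Eiter lam n w) - Re (Eiter lam n z))).
  specialize (Hw w Hwz). unfold x. lra.
Qed.

(** * The chordal metric, and the Julia set as an orbit condition *)

Lemma sqrt_ge_1 (x : R) : 1 <= x -> 1 <= sqrt x.
Proof. intros H. rewrite <- sqrt_1. now apply sqrt_le_1_alt. Qed.

Lemma sqrt_chordal_ge_1 (z w : C) : 1 <= sqrt ((1 + cabs z ^ 2) * (1 + cabs w ^ 2)).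
Proof.
  apply sqrt_ge_1. pose proof (pow2_ge_0 (cabs z)). pose proof (pow2_ge_0 (cabs w)).
  rewrite <- (Rmult_1_l 1) at 1. apply Rmult_le_compat; lra.
Qed.

Lemma chordal_le_cdist (z w : C) : chordal (Some z) (Some w) <= 2 * cdist z w.
Proof.
  cbn [chordal]. pose proof (cdist_nonneg z w).
  pose proof (sqrt_chordal_ge_1 z w) as Hs.
  apply (Rmult_le_reg_r (sqrt ((1 + cabs z ^ 2) * (1 + cabs w ^ 2)))); [lra|].
  unfold Rdiv. rewrite Rmult_assoc, Rinv_l by lra.
  apply Rmult_le_compat_l with (r := 2 * cdist z w) in Hs; lra.
Qed.

Lemma Julia_Re_ge (lam a b : R) (z : C) :
  0 < lam -> lam < exp (-1) -> 0 < a -> a < 1 -> 1 < b -> lam * exp a = a -> lam * exp b = b ->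
  Julia lam z -> forall n, b <= Re (Eiter lam n z).
Proof.
  intros Hl Hl1 Ha0 Ha1 Hb1 Ha Hb HJ n. apply Rnot_lt_le. intros Hn. apply HJ.
  destruct (basin_uniform lam a b n z) as (r & Hr & HN); try assumption.
  exists r. split; [easy|]. intros phi Hphi.
  exists (fun k => k), (fun _ => Some (a, 0)). split; [intros i j Hij; exact Hij|].
  intros rho eps Hrho Hrr He. destruct (HN (eps / 2) ltac:(lra)) as [N HN'].
  exists N. intros k w Hk Hw.
  assert (Hge : (k <= phi k)%nat).
  { clear - Hphi. induction k as [|k IH]; [lia|]. pose proof (Hphi k (S k) ltac:(lia)). lia. }
  specialize (HN' w (phi k) ltac:(lra) ltac:(lia)).
  cbv beta. eapply Rle_lt_trans; [apply chordal_le_cdist|]. lra.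
Qed.

Lemma cdist_lt_of_chordal (p w : C) (eps : R) : 0 < eps -> chordal (Some p) (Some w) < eps ->
  2 * cdist p w < eps * ((1 + cabs p) * (1 + cabs w)).
Proof.
  intros He H. cbn [chordal] in H.
  pose proof (cabs_nonneg p); pose proof (cabs_nonneg w).
  set (s := sqrt ((1 + cabs p ^ 2) * (1 + cabs w ^ 2))) in *.
  pose proof (sqrt_chordal_ge_1 p w : 1 <= s) as Hs1.
  assert (Hs : s <= (1 + cabs p) * (1 + cabs w)).
  { unfold s. rewrite <- (sqrt_square ((1 + cabs p) * (1 + cabs w))) by nra.
    apply sqrt_le_1_alt.
    replace ((1 + cabs p) * (1 + cabs w) * ((1 + cabs p) * (1 + cabs w)))
      with (((1 + cabs p) * (1 + cabs p)) * ((1 + cabs w) * (1 + cabs w))) by ring.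
    apply Rmult_le_compat; nra. }
  apply (Rmult_lt_compat_r s) in H; [|lra].
  unfold Rdiv in H. rewrite Rmult_assoc, Rinv_l in H by lra. nra.
Qed.

(** Stands in for a triangle inequality of the chordal metric. A finite G close to q has modulus
    below 1 + 3 eps, too small to be close to p; G at infinity has chordal distance at least 1 from
    q. *)
Lemma chordal_separation (th : R) : 0 < th -> exists eps, 0 < eps /\ forall G p q,
  cabs q <= 1 -> 1 + th <= cabs p -> chordal (Some p) G < eps -> chordal (Some q) G < eps -> False.
Proof.
  intros Hth. set (eps := th / (10 * (1 + th))).
  assert (He : eps * (10 * (1 + th)) = th) by (unfold eps; field; lra).
  assert (He0 : 0 < eps) by (apply Rdiv_lt_0_compat; lra).
  assert (He1 : eps < 1 / 10) by nra.
  exists eps. split; [easy|]. intros [w|] p q Hq Hp H1 H2.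
  - apply cdist_lt_of_chordal in H1, H2; try easy.
    pose proof (cabs_cdist p w) as H3. pose proof (cabs_cdist w q) as H4. rewrite cdist_sym in H4.
    pose proof (cabs_nonneg q). pose proof (cabs_nonneg w). pose proof (cdist_nonneg p w).
    assert (A5 : cabs w < 1 + eps * (1 + cabs w)).
    { assert ((1 + cabs q) * (1 + cabs w) <= 2 * (1 + cabs w)) by nra. nra. }
    assert (A6 : cabs w < 2) by nra.
    assert (A7 : cabs w < 1 + 3 * eps) by nra.
    assert (A8 : 2 * cdist p w < eps * (3 * (1 + cabs p))).
    { eapply Rlt_le_trans; [exact H1|]. apply Rmult_le_compat_l; [lra|]. nra. }
    nra.
  - cbn [chordal] in H2. pose proof (cabs_nonneg q).
    assert (Hs : sqrt (1 + cabs q ^ 2) <= 2).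
    { rewrite <- (sqrt_square 2) by lra. apply sqrt_le_1_alt. nra. }
    assert (Hs1 : 1 <= sqrt (1 + cabs q ^ 2)).
    { apply sqrt_ge_1. pose proof (pow2_ge_0 (cabs q)). lra. }
    apply (Rmult_lt_compat_r (sqrt (1 + cabs q ^ 2))) in H2; [|lra].
    unfold Rdiv in H2. rewrite Rmult_assoc, Rinv_l in H2 by lra. nra.
Qed.

Lemma pullback_point (lam b : R) (j : nat) : 0 < lam -> 1 < b -> lam * exp b = b ->
  forall z v, (forall n, b <= Re (Eiter lam n z)) -> b <= Re v ->
  exists w, Eiter lam j w = v /\ cdist w z <= (/ b) ^ j * cdist v (Eiter lam j z).
Proof.
  intros Hl Hb1 Hb z v Hz Hv.
  (* The bound on Re w is carried along because [L_lipschitz] needs it at the next pull-back. *)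
  assert (H : exists w, b <= Re w /\ Eiter lam j w = v /\
                        cdist w z <= (/ b) ^ j * cdist v (Eiter lam j z)).
  { revert z Hz. induction j as [|j IH]; intros z Hz.
    - exists v. cbn. repeat split; try easy. lra.
    - destruct (IH (E lam z)) as (w & Hw1 & Hw2 & Hw3).
      { intros n. rewrite <- Eiter_succ. apply Hz. }
      assert (HEz : b <= Re (E lam z)) by exact (Hz 1%nat).
      exists (L lam (strip z) w). repeat split.
      + now apply Re_L_ge.
      + rewrite Eiter_succ, E_L by lra. easy.
      + rewrite Eiter_succ. rewrite <- (L_E lam z) at 2 by lra.
        pose proof (L_lipschitz lam b (strip z) w (E lam z) Hl ltac:(lra) Hw1 HEz) as HL.
        cbn [pow]. pose proof (Rinv_0_lt_compat b ltac:(lra)).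
        apply (Rmult_le_reg_l b); [lra|]. apply Rle_trans with (1 := HL).
        rewrite <- !Rmult_assoc, Rinv_r, Rmult_1_l by lra. exact Hw3. }
  destruct H as (w & _ & H). now exists w.
Qed.

(* Pulling E^j(z) + i pi back to z gives points w near z with E^(j+1)(w) = - E^(j+1)(z), hence
   in the basin of a.  A chordal limit function would have to be a at such w, while it stays
   away from a at points where E^n is close to E^n(z). *)
Lemma Re_ge_Julia (lam a b : R) (z : C) :
  0 < lam -> lam < exp (-1) -> 0 < a -> a < 1 -> 1 < b -> lam * exp a = a -> lam * exp b = b ->
  (forall n, b <= Re (Eiter lam n z)) -> Julia lam z.
Proof.
  intros Hl Hl1 Ha0 Ha1 Hb1 Ha Hb Hz (r & Hr & Hnorm).
  destruct (Hnorm (fun n => n)) as (psi & g & Hpsi & Hg); [intros i j Hij; exact Hij|].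
  (* b - th = 1 + th, so points within [th] of the orbit of z still have modulus at least 1 + th. *)
  set (th := (b - 1) / 2).
  destruct (chordal_separation th ltac:(unfold th; lra)) as (eps & He & Hsep).
  destruct (Hg (r / 2) eps) as [N HN]; try lra.
  (* [N] is fixed before w is chosen, so continuity of the single iterate with index [psi N] is
     enough. *)
  destruct (Eiter_continuous lam (psi N) z th Hl ltac:(unfold th; lra)) as (del & Hd & Hdel).
  destruct (inv_lt_1 b Hb1) as [Hib Hib1].
  pose proof PI_RGT_0 as HPI.
  destruct (pow_small (/ b) PI (Rmin del (r / 2))) as [j Hj]; try lra.
  { apply Rmin_glb_lt; lra. }
  set (v := Eiter lam j z). specialize (Hj j (le_n j)).
  pose proof (Rmin_l del (r / 2)). pose proof (Rmin_r del (r / 2)).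
  destruct (pullback_point lam b j Hl Hb1 Hb z (Re v, Im v + PI) Hz (Hz j)) as (w & Hw1 & Hw2).
  fold v in Hw2.
  assert (Hvv : cdist (Re v, Im v + PI) v = PI).
  { unfold cdist. cbn [Re Im fst snd]. fold (Re v) (Im v).
    unfold cabs. cbn [Re Im fst snd].
    replace ((Re v - Re v) * (Re v - Re v) + (Im v + PI - Im v) * (Im v + PI - Im v)) with (PI * PI) by ring.
    apply sqrt_square. lra. }
  rewrite Hvv in Hw2.
  assert (Hbas : Re (Eiter lam (S j) w) < b).
  { change (Eiter lam (S j) w) with (E lam (Eiter lam j w)). rewrite Hw1.
    unfold E. cbn [Re Im fst snd]. rewrite neg_cos.
    pose proof (Hz (S j)) as Hzj. change (Eiter lam (S j) z) with (E lam v) in Hzj.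
    unfold E in Hzj. cbn [Re Im fst snd] in Hzj. unfold Re, Im in *. lra. }
  destruct (basin_uniform lam a b (S j) w Hl Hl1 Ha0 Ha1 Hb1 Ha Hb Hbas) as (r' & Hr' & Hconv).
  (* Within 1 - a of a the modulus is at most 1, as the separation lemma requires. *)
  destruct (Hconv (1 - a) ltac:(lra)) as [M HM].
  assert (Hge : forall k, (k <= psi k)%nat).
  { intros k. clear - Hpsi. induction k as [|k IH]; [lia|]. pose proof (Hpsi k (S k) ltac:(lia)). lia. }
  apply (Hsep (g w) (Eiter lam (psi N) w) (Eiter lam (psi (N + M)%nat) w)).
  - specialize (HM w (psi (N + M)%nat)). rewrite cdist_refl in HM.
    specialize (HM ltac:(lra)). pose proof (Hge (N + M)%nat). specialize (HM ltac:(lia)).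
    pose proof (cabs_cdist (Eiter lam (psi (N + M)%nat) w) (a, 0)) as H3.
    assert (cabs (a, 0) <= a) by (apply cabs_le; [lra|]; cbn; clear; nra). lra.
  - specialize (Hdel w ltac:(lra)).
    pose proof (Rabs_Re_le_cdist (Eiter lam (psi N) w) (Eiter lam (psi N) z)) as H3.
    pose proof (Rle_abs (- (Re (Eiter lam (psi N) w) - Re (Eiter lam (psi N) z)))) as H4.
    rewrite Rabs_Ropp in H4. pose proof (Hz (psi N)).
    pose proof (Re_le_cabs (Eiter lam (psi N) w)). unfold th in *. lra.
  - apply HN; [lia|lra].
  - apply HN; [lia|lra].
Qed.

(** ** Hairs as curves *)

Definition orbit_ge (lam b : R) (z : C) : Prop := forall n, b <= Re (Eiter lam n z).

Definition same_strips (lam : R) (z w : C) : Prop :=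
  forall n, strip (Eiter lam n z) = strip (Eiter lam n w).

(* The n-th approximation pulls back z_n + T along the orbit of z, where T is the image of t
   under the real model maps t |-> |z_(j+1)| (exp t - 1). *)
Fixpoint hair_approx (lam : R) (n : nat) (z : C) (t : R) : C :=
  match n with
  | O => (Re z + t, Im z)
  | S n => L lam (strip z) (hair_approx lam n (E lam z) (cabs (E lam z) * (exp t - 1)))
  end.

Lemma orbit_ge_E (lam b : R) (z : C) : orbit_ge lam b z -> orbit_ge lam b (E lam z).
Proof. intros H n. rewrite <- Eiter_succ. apply H. Qed.

Lemma orbit_ge_Eiter (lam b : R) (k : nat) (z : C) : orbit_ge lam b z -> orbit_ge lam b (Eiter lam k z).
Proof. intros H n. rewrite <- Eiter_add. apply H. Qed.

Lemma same_strips_E (lam : R) (z w : C) : same_strips lam z w -> same_strips lam (E lam z) (E lam w).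
Proof. intros H n. rewrite <- !Eiter_succ. apply H. Qed.

Lemma model_nonneg (lam t : R) (z : C) : 0 <= t -> 0 <= cabs (E lam z) * (exp t - 1).
Proof.
  intros Ht. pose proof (cabs_nonneg (E lam z)). pose proof (exp_ineq1_le t).
  apply Rmult_le_pos; lra.
Qed.

Lemma hair_approx_Re (lam b : R) (n : nat) : 0 < lam -> lam * exp b = b ->
  forall z t, orbit_ge lam b z -> 0 <= t -> b <= Re (hair_approx lam n z t).
Proof.
  intros Hl Hb. induction n as [|n IH]; intros z t Hz Ht.
  - pose proof (Hz 0%nat) as H0. cbn in *. unfold Re in *. lra.
  - cbn [hair_approx]. apply Re_L_ge; try assumption. apply IH; [now apply orbit_ge_E|].
    now apply model_nonneg.
Qed.

(** With r = |E z| and T = r (exp t - 1), r + T = r exp t. Then |E z + T| is at most r exp t and at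
    least max (r, T) >= r exp t / 2 >= r exp (t - 1). So the logarithm misses Re z + t by at most 1,
    the argument by at most PI, and 1 + PI <= 5. *)
Lemma hair_approx_base (lam b : R) (z : C) (t : R) : 0 < lam -> 1 < b -> lam * exp b = b ->
  orbit_ge lam b z -> 0 <= t ->
  cdist (hair_approx lam 1 z t) (hair_approx lam 0 z t) <= 5.
Proof.
  intros Hl Hb1 Hb Hz Ht. cbn [hair_approx].
  set (w := E lam z). set (r := cabs w).
  assert (HEz : b <= Re w) by exact (Hz 1%nat).
  assert (Hr : r = lam * exp (Re z)) by (unfold r, w; now apply cabs_E).
  assert (Hr0 : 0 < r) by (rewrite Hr; pose proof (exp_pos (Re z)); nra).
  pose proof (model_nonneg lam t z Ht) as Hm. fold w r in Hm.
  set (T := r * (exp t - 1)) in *.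
  assert (HT : r + T = r * exp t) by (unfold T; ring).
  assert (Hup : cabs (Re w + T, Im w) <= r * exp t).
  { pose proof (cabs_add w (T, 0)) as H. cbn [Re Im fst snd] in H. fold (Re w) (Im w) in H.
    rewrite Rplus_0_r in H.
    assert (cabs (T, 0) <= T) by (apply cabs_le; cbn; lra). fold r in H. lra. }
  assert (Hlo : r * exp (t - 1) <= cabs (Re w + T, Im w)).
  { assert (r <= cabs (Re w + T, Im w)).
    { apply le_cabs. unfold r. rewrite cabs_sqr. cbn [Re Im fst snd]. unfold Re, Im in *. nra. }
    pose proof (Re_le_cabs (Re w + T, Im w)) as H2. cbn [Re fst] in H2. fold (Re w) in H2.
    assert (r * exp (t - 1) <= r * exp t / 2).
    { replace t with (t - 1 + 1) at 2 by ring. rewrite exp_plus.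
      pose proof (exp_ineq1_le 1). pose proof (exp_pos (t - 1)).
      assert (0 < r * exp (t - 1)) by nra. nra. }
    lra. }
  assert (Hln : t - 1 <= ln (cabs (Re w + T, Im w) / lam) - Re z <= t).
  { assert (Hx : forall u, ln (r * exp u / lam) = Re z + u).
    { intros u. rewrite Hr. replace (lam * exp (Re z) * exp u / lam) with (exp (Re z + u)).
      - apply ln_exp. - rewrite exp_plus. field. lra. }
    pose proof (exp_pos (t - 1)). assert (0 < r * exp (t - 1)) by nra.
    assert (Hd : forall x y, x <= y -> x / lam <= y / lam).
    { intros x y Hxy. apply Rmult_le_compat_r; [|easy]. left. now apply Rinv_0_lt_compat. }
    split.
    - assert (H3 : ln (r * exp (t - 1) / lam) <= ln (cabs (Re w + T, Im w) / lam)).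
      { apply ln_le_mono; [now apply Rdiv_lt_0_compat|]. now apply Hd. }
      rewrite Hx in H3. lra.
    - assert (H3 : ln (cabs (Re w + T, Im w) / lam) <= ln (r * exp t / lam)).
      { apply ln_le_mono; [apply Rdiv_lt_0_compat; lra|]. now apply Hd. }
      rewrite Hx in H3. lra. }
  eapply Rle_trans; [apply cdist_le_sum|]. unfold L. cbn [Re Im fst snd].
  fold (Re z) (Im z) (Re w) (Im w).
  assert (HI : Rabs (atan (Im w / (Re w + T)) + 2 * IZR (strip z) * PI - Im z) <= PI).
  { pose proof (atan_bound (Im w / (Re w + T))).
    pose proof (strip_half z (cos_Im_pos lam z Hl ltac:(fold w; lra))) as Hs.
    apply Rabs_def2 in Hs. apply Rabs_le. lra. }
  assert (HR : Rabs (ln (cabs (Re w + T, Im w) / lam) - (Re z + t)) <= 1) by (apply Rabs_le; lra).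
  pose proof PI_4. lra.
Qed.

Lemma hair_approx_step (lam b : R) (n : nat) : 0 < lam -> 1 < b -> lam * exp b = b ->
  forall z t, orbit_ge lam b z -> 0 <= t ->
  cdist (hair_approx lam (S n) z t) (hair_approx lam n z t) <= 5 * (/ b) ^ n.
Proof.
  intros Hl Hb1 Hb. induction n as [|n IH]; intros z t Hz Ht.
  - rewrite pow_O, Rmult_1_r. now apply (hair_approx_base lam b).
  - change (cdist (L lam (strip z) (hair_approx lam (S n) (E lam z) (cabs (E lam z) * (exp t - 1))))
              (L lam (strip z) (hair_approx lam n (E lam z) (cabs (E lam z) * (exp t - 1))))
            <= 5 * (/ b) ^ S n).
    pose proof (orbit_ge_E _ _ _ Hz) as HEz. pose proof (model_nonneg lam t z Ht) as Hm.
    apply (Rmult_le_reg_l b); [lra|].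
    eapply Rle_trans; [apply L_lipschitz; try lra; apply hair_approx_Re; assumption|].
    cbn [pow]. replace (b * (5 * (/ b * (/ b) ^ n))) with (5 * (/ b) ^ n) by (field; lra).
    now apply IH.
Qed.

Lemma geometric_limit (u : nat -> C) (A k : R) : 0 <= A -> 0 <= k -> k < 1 ->
  (forall n, cdist (u (S n)) (u n) <= A * k ^ n) ->
  exists p, forall n, cdist p (u n) <= A / (1 - k) * k ^ n.
Proof.
  intros HA Hk0 Hk1 Hu.
  assert (HB : 0 <= A / (1 - k)) by (apply Rmult_le_pos; [easy | left; apply Rinv_0_lt_compat; lra]).
  assert (Htel : forall n m, cdist (u (n + m)%nat) (u n) <= A / (1 - k) * (k ^ n - k ^ (n + m))).
  { intros n m. induction m as [|m IH].
    - rewrite Nat.add_0_r, cdist_refl. lra.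
    - pose proof (cdist_triangle (u (n + S m)%nat) (u (n + m)%nat) (u n)).
      rewrite Nat.add_succ_r in *. specialize (Hu (n + m)%nat).
      replace (A / (1 - k) * (k ^ n - k ^ S (n + m)))
        with (A / (1 - k) * (k ^ n - k ^ (n + m)) + A * k ^ (n + m)) by (cbn [pow]; field; lra).
      lra. }
  assert (Htail : forall n m, (n <= m)%nat -> cdist (u m) (u n) <= A / (1 - k) * k ^ n).
  { intros n m Hnm. replace m with (n + (m - n))%nat by lia.
    eapply Rle_trans; [apply Htel|]. apply Rmult_le_compat_l; [easy|].
    pose proof (pow_le k (n + (m - n)) Hk0). lra. }
  assert (Hcau : forall f : C -> R, (forall z w, Rabs (f z - f w) <= cdist z w) ->
    Cauchy_crit (fun n => f (u n))).
  { intros f Hf eps He. destruct (pow_small k (A / (1 - k)) (eps / 2)) as [N HN]; try lra.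
    exists N. intros n m Hn Hm. unfold Rdist.
    eapply Rle_lt_trans; [apply Hf|].
    pose proof (cdist_triangle (u n) (u N) (u m)). rewrite (cdist_sym (u N)) in H.
    pose proof (Htail N n Hn). pose proof (Htail N m Hm). specialize (HN N (le_n N)). lra. }
  destruct (R_complete _ (Hcau Re Rabs_Re_le_cdist)) as [x Hx].
  destruct (R_complete _ (Hcau Im Rabs_Im_le_cdist)) as [y Hy].
  exists (x, y). intros n. apply le_epsilon. intros eps He.
  destruct (Hx (eps / 2) ltac:(lra)) as [N1 H1]. destruct (Hy (eps / 2) ltac:(lra)) as [N2 H2].
  set (m := (n + N1 + N2)%nat).
  specialize (H1 m ltac:(unfold m; lia)). specialize (H2 m ltac:(unfold m; lia)).
  unfold Rdist in H1, H2. rewrite Rabs_minus_sym in H1, H2.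
  pose proof (cdist_triangle (x, y) (u m) (u n)). pose proof (Htail n m ltac:(unfold m; lia)).
  pose proof (cdist_le_sum (x, y) (u m)) as H3. cbn [Re Im fst snd] in H3.
  fold (Re (u m)) (Im (u m)) in H3. lra.
Qed.

(** The limit curve is recorded through its rate of approximation, uniform in z and t; its
    properties follow from those of [hair_approx] by [le_of_pow]. *)
Definition is_hair_map (lam b A : R) (gam : C -> R -> C) : Prop :=
  forall z t, orbit_ge lam b z -> 0 <= t ->
  forall n, cdist (gam z t) (hair_approx lam n z t) <= A * (/ b) ^ n.

Lemma hair_map_exists (lam b : R) : 0 < lam -> 1 < b -> lam * exp b = b ->
  exists A gam, 0 <= A /\ is_hair_map lam b A gam.
Proof.
  intros Hl Hb1 Hb. destruct (inv_lt_1 b Hb1) as [Hib Hib1].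
  exists (5 / (1 - / b)).
  destruct (functional_choice (fun (zt : C * R) p => orbit_ge lam b (fst zt) -> 0 <= snd zt ->
    forall n, cdist p (hair_approx lam n (fst zt) (snd zt)) <= 5 / (1 - / b) * (/ b) ^ n)) as [f Hf].
  { intros [z t]. cbn [fst snd].
    destruct (classic (orbit_ge lam b z /\ 0 <= t)) as [[Hz Ht]|Hn].
    - destruct (geometric_limit (fun n => hair_approx lam n z t) 5 (/ b)) as [p Hp]; try lra.
      + intros n. now apply hair_approx_step.
      + now exists p.
    (* An arbitrary value outside the domain, so that choice yields a total function. *)
    - exists z. tauto. }
  exists (fun z t => f (z, t)). split.
  - apply Rmult_le_pos; [lra|]. left. apply Rinv_0_lt_compat. lra.
  - intros z t Hz Ht n. exact (Hf (z, t) Hz Ht n).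
Qed.

Lemma le_of_pow (x D k : R) : 0 <= k -> k < 1 -> 0 <= D -> (forall n : nat, x <= D * k ^ n) -> x <= 0.
Proof.
  intros H0 H1 HD H. apply le_epsilon. intros eps He.
  destruct (pow_small k D eps H0 H1 HD He) as [N HN]. specialize (H N). specialize (HN N (le_n N)). lra.
Qed.

Lemma hair_map_Re (lam b A : R) (gam : C -> R -> C) (z : C) (t : R) :
  0 < lam -> 1 < b -> lam * exp b = b -> 0 <= A -> is_hair_map lam b A gam ->
  orbit_ge lam b z -> 0 <= t -> b <= Re (gam z t).
Proof.
  intros Hl Hb1 Hb HA Hg Hz Ht. destruct (inv_lt_1 b Hb1).
  cut (b - Re (gam z t) <= 0); [lra|]. apply (le_of_pow _ A (/ b)); try lra. intros n.
  pose proof (Hg z t Hz Ht n) as H1.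
  pose proof (hair_approx_Re lam b n Hl Hb z t Hz Ht).
  pose proof (Rabs_Re_le_cdist (gam z t) (hair_approx lam n z t)) as H3.
  pose proof (Rle_abs (- (Re (gam z t) - Re (hair_approx lam n z t)))) as H4.
  rewrite Rabs_Ropp in H4. lra.
Qed.

(** The recursion of [hair_approx] in the limit: E acts on the curves through the model map of the
    parameter. *)
Lemma hair_map_equation (lam b A : R) (gam : C -> R -> C) (z : C) (t : R) :
  0 < lam -> 1 < b -> lam * exp b = b -> 0 <= A -> is_hair_map lam b A gam ->
  orbit_ge lam b z -> 0 <= t ->
  gam z t = L lam (strip z) (gam (E lam z) (cabs (E lam z) * (exp t - 1))).
Proof.
  intros Hl Hb1 Hb HA Hg Hz Ht. destruct (inv_lt_1 b Hb1) as [Hi0 Hi1].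
  pose proof (orbit_ge_E _ _ _ Hz) as HEz. pose proof (model_nonneg lam t z Ht) as Hm.
  apply cdist_le0_eq. apply (le_of_pow _ (2 * A) (/ b)); try lra. intros n.
  set (T := cabs (E lam z) * (exp t - 1)) in *.
  pose proof (cdist_triangle (gam z t) (hair_approx lam (S n) z t) (L lam (strip z) (gam (E lam z) T))) as H1.
  pose proof (Hg z t Hz Ht (S n)) as H2.
  pose proof (Hg (E lam z) T HEz Hm n) as H3. rewrite cdist_sym in H3.
  pose proof (L_lipschitz lam b (strip z) (hair_approx lam n (E lam z) T) (gam (E lam z) T) Hl
    ltac:(lra) (hair_approx_Re lam b n Hl Hb _ _ HEz Hm)
    (hair_map_Re lam b A gam _ _ Hl Hb1 Hb HA Hg HEz Hm)) as H4.
  change (L lam (strip z) (hair_approx lam n (E lam z) T)) with (hair_approx lam (S n) z t) in H4.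
  pose proof (cdist_nonneg (hair_approx lam (S n) z t) (L lam (strip z) (gam (E lam z) T))).
  assert (0 <= A * (/ b) ^ n) by (apply Rmult_le_pos; [easy | apply pow_le; lra]).
  assert (A * (/ b) ^ S n <= A * (/ b) ^ n).
  { cbn [pow]. nra. }
  nra.
Qed.

Fixpoint model_iter (lam : R) (k : nat) (z : C) (t : R) : R :=
  match k with
  | O => t
  | S k => model_iter lam k (E lam z) (cabs (E lam z) * (exp t - 1))
  end.

Lemma model_iter_nonneg (lam : R) (k : nat) : forall z t, 0 <= t -> 0 <= model_iter lam k z t.
Proof. induction k as [|k IH]; intros z t Ht; [easy|]. cbn. apply IH. now apply model_nonneg. Qed.

Lemma hair_map_iter (lam b A : R) (gam : C -> R -> C) (k : nat) :
  0 < lam -> 1 < b -> lam * exp b = b -> 0 <= A -> is_hair_map lam b A gam ->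
  forall z t, orbit_ge lam b z -> 0 <= t ->
  Eiter lam k (gam z t) = gam (Eiter lam k z) (model_iter lam k z t).
Proof.
  intros Hl Hb1 Hb HA Hg. induction k as [|k IH]; intros z t Hz Ht; [reflexivity|].
  pose proof (orbit_ge_E _ _ _ Hz) as HEz. pose proof (model_nonneg lam t z Ht) as Hm.
  rewrite !Eiter_succ. rewrite (hair_map_equation lam b A gam z t) by assumption.
  rewrite E_L; [now apply IH| easy |].
  pose proof (hair_map_Re lam b A gam _ _ Hl Hb1 Hb HA Hg HEz Hm). lra.
Qed.

Lemma hair_map_in_hair (lam b A : R) (gam : C -> R -> C) (z : C) (t : R) :
  0 < lam -> 1 < b -> lam * exp b = b -> 0 <= A -> is_hair_map lam b A gam ->
  orbit_ge lam b z -> 0 <= t -> orbit_ge lam b (gam z t) /\ same_strips lam z (gam z t).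
Proof.
  intros Hl Hb1 Hb HA Hg Hz Ht. split; intros n.
  - rewrite (hair_map_iter lam b A) by assumption.
    apply (hair_map_Re lam b A); try assumption; [now apply orbit_ge_Eiter | now apply model_iter_nonneg].
  - rewrite (hair_map_iter lam b A) by assumption.
    rewrite (hair_map_equation lam b A); try assumption;
      [now rewrite strip_L | now apply orbit_ge_Eiter | now apply model_iter_nonneg].
Qed.

(** Each model map has slope |E z| exp t, at least b for t >= 0. *)
Lemma model_iter_expand (lam b : R) (k : nat) : 1 < b -> forall z t u,
  orbit_ge lam b z -> 0 <= t -> t <= u ->
  b ^ k * (u - t) <= model_iter lam k z u - model_iter lam k z t.
Proof.
  intros Hb1. induction k as [|k IH]; intros z t u Hz Ht Htu; [cbn; lra|].
  cbn [model_iter pow].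
  pose proof (Hz 1%nat : b <= Re (E lam z)) as H1. pose proof (Re_le_cabs (E lam z)) as H2.
  set (r := cabs (E lam z)) in *.
  assert (He : u - t <= exp u - exp t).
  { replace u with (t + (u - t)) at 2 by ring. rewrite exp_plus.
    pose proof (exp_ineq1_le (u - t)). pose proof (exp_ineq1_le t). nra. }
  assert (Hd : b * (u - t) <= r * (exp u - 1) - r * (exp t - 1)).
  { replace (r * (exp u - 1) - r * (exp t - 1)) with (r * (exp u - exp t)) by ring.
    apply Rmult_le_compat; lra. }
  pose proof (pow_lt b k ltac:(lra)).
  eapply Rle_trans; [|apply IH; [now apply orbit_ge_E | now apply model_nonneg | nra]].
  rewrite (Rmult_comm b), Rmult_assoc. apply Rmult_le_compat_l; lra.
Qed.

Lemma hair_map_asymptotic (lam b A : R) (gam : C -> R -> C) (z : C) (t : R) :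
  is_hair_map lam b A gam -> orbit_ge lam b z -> 0 <= t ->
  cdist (gam z t) (Re z + t, Im z) <= A.
Proof. intros Hg Hz Ht. pose proof (Hg z t Hz Ht 0%nat) as H. cbn [pow hair_approx] in H. lra. Qed.

Lemma pow_unbounded (b d M : R) : 1 < b -> 0 < d -> exists N : nat, forall n, (N <= n)%nat -> M < b ^ n * d.
Proof.
  intros Hb Hd. destruct (Pow_x_infinity b ltac:(rewrite Rabs_right; lra) (M / d + 1)) as [N HN].
  exists N. intros n Hn. specialize (HN n Hn). rewrite Rabs_right in HN by (apply Rle_ge, pow_le; lra).
  apply Rge_le in HN. apply (Rmult_le_compat_r d) in HN; [|lra].
  replace ((M / d + 1) * d) with (M + d) in HN by (field; lra). lra.
Qed.

(** A coincidence persists under iteration while the parameters separate by more than 2 A; yet each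
    curve stays within A of its horizontal ray. *)
Lemma hair_map_injective (lam b A : R) (gam : C -> R -> C) (z : C) (t u : R) :
  0 < lam -> 1 < b -> lam * exp b = b -> 0 <= A -> is_hair_map lam b A gam ->
  orbit_ge lam b z -> 0 <= t -> t < u -> gam z t <> gam z u.
Proof.
  intros Hl Hb1 Hb HA Hg Hz Ht Htu Heq.
  destruct (pow_unbounded b (u - t) (2 * A) Hb1 ltac:(lra)) as [k Hk]. specialize (Hk k (le_n k)).
  pose proof (model_iter_expand lam b k Hb1 z t u Hz Ht ltac:(lra)) as H1.
  pose proof (hair_map_iter lam b A gam k Hl Hb1 Hb HA Hg z t Hz Ht) as H2.
  pose proof (hair_map_iter lam b A gam k Hl Hb1 Hb HA Hg z u Hz ltac:(lra)) as H3.
  rewrite Heq, H3 in H2.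
  pose proof (orbit_ge_Eiter lam b k z Hz) as Hzk.
  pose proof (model_iter_nonneg lam k z t Ht) as Ht'. pose proof (model_iter_nonneg lam k z u ltac:(lra)) as Hu'.
  set (zk := Eiter lam k z) in *. set (t' := model_iter lam k z t) in *. set (u' := model_iter lam k z u) in *.
  pose proof (hair_map_asymptotic lam b A gam zk t' Hg Hzk Ht') as H4.
  pose proof (hair_map_asymptotic lam b A gam zk u' Hg Hzk Hu') as H5.
  rewrite H2 in H5. rewrite cdist_sym in H5.
  pose proof (cdist_triangle (Re zk + u', Im zk) (gam zk t') (Re zk + t', Im zk)) as H6.
  pose proof (Rabs_Re_le_cdist (Re zk + u', Im zk) (Re zk + t', Im zk)) as H7.
  cbn [Re fst] in H7. fold (Re zk) in H7.
  pose proof (Rle_abs (Re zk + u' - (Re zk + t'))). lra.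
Qed.

Lemma hair_approx_0 (lam b : R) (n : nat) : 0 < lam -> 1 < b ->
  forall z, orbit_ge lam b z -> hair_approx lam n z 0 = z.
Proof.
  intros Hl Hb1. induction n as [|n IH]; intros z Hz.
  - cbn. unfold Re, Im. rewrite Rplus_0_r. now destruct z.
  - cbn [hair_approx]. rewrite exp_0, Rminus_diag, Rmult_0_r, IH by now apply orbit_ge_E.
    apply L_E; [easy|]. pose proof (Hz 1%nat : b <= Re (E lam z)). lra.
Qed.

Lemma exp_continuous (t eps : R) : 0 < eps -> exists del, 0 < del /\
  forall u, Rabs (u - t) < del -> Rabs (exp u - exp t) < eps.
Proof.
  intros He. destruct (derivable_continuous _ derivable_exp t eps He) as (del & Hd & H).
  exists del. split; [easy|]. intros u Hu. destruct (Req_dec u t) as [->|Hn].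
  - rewrite Rminus_diag, Rabs_R0. easy.
  - apply (H u). split; [|exact Hu]. split; [exact I|]. auto.
Qed.

Lemma hair_approx_continuous (lam b : R) (n : nat) : 0 < lam -> 1 < b -> lam * exp b = b ->
  forall z t eps, orbit_ge lam b z -> 0 <= t -> 0 < eps -> exists del, 0 < del /\
  forall u, 0 <= u -> Rabs (u - t) < del -> cdist (hair_approx lam n z u) (hair_approx lam n z t) < eps.
Proof.
  intros Hl Hb1 Hb. induction n as [|n IH]; intros z t eps Hz Ht He.
  - exists eps. split; [easy|]. intros u _ Hu. cbn [hair_approx].
    eapply Rle_lt_trans; [apply cdist_le_sum|]. cbn [Re Im fst snd].
    rewrite Rminus_diag, Rabs_R0. replace (fst z + u - (fst z + t)) with (u - t) by ring.
    unfold Re. replace (fst z + u - (fst z + t)) with (u - t) by ring. lra.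
  - pose proof (orbit_ge_E _ _ _ Hz) as HEz.
    pose proof (Hz 1%nat : b <= Re (E lam z)) as H1. pose proof (Re_le_cabs (E lam z)) as H2.
    cbn [hair_approx]. set (r := cabs (E lam z)) in *.
    destruct (IH (E lam z) (r * (exp t - 1)) eps HEz (model_nonneg lam t z Ht) He) as (d1 & Hd1 & Hc1).
    destruct (exp_continuous t (d1 / r)) as (d2 & Hd2 & Hc2); [apply Rdiv_lt_0_compat; lra|].
    exists d2. split; [easy|]. intros u Hu Hut.
    specialize (Hc2 u Hut). pose proof (model_nonneg lam u z Hu) as Hmu.
    pose proof (model_nonneg lam t z Ht) as Hmt. fold r in Hmu, Hmt.
    assert (Hr : Rabs (r * (exp u - 1) - r * (exp t - 1)) < d1).
    { replace (r * (exp u - 1) - r * (exp t - 1)) with (r * (exp u - exp t)) by ring.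
      rewrite Rabs_mult, (Rabs_right r) by lra.
      replace d1 with (r * (d1 / r)) by (field; lra). apply Rmult_lt_compat_l; lra. }
    specialize (Hc1 _ Hmu Hr).
    pose proof (L_lipschitz lam b (strip z) (hair_approx lam n (E lam z) (r * (exp u - 1)))
      (hair_approx lam n (E lam z) (r * (exp t - 1))) Hl ltac:(lra)
      (hair_approx_Re lam b n Hl Hb _ _ HEz Hmu) (hair_approx_Re lam b n Hl Hb _ _ HEz Hmt)) as HL.
    pose proof (cdist_nonneg (L lam (strip z) (hair_approx lam n (E lam z) (r * (exp u - 1))))
      (L lam (strip z) (hair_approx lam n (E lam z) (r * (exp t - 1))))).
    nra.
Qed.

Lemma hair_map_continuous (lam b A : R) (gam : C -> R -> C) (z : C) :
  0 < lam -> 1 < b -> lam * exp b = b -> 0 <= A -> is_hair_map lam b A gam -> orbit_ge lam b z ->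
  forall t eps, 0 <= t -> 0 < eps -> exists del, 0 < del /\
    forall u, 0 <= u -> Rabs (u - t) < del -> cdist (gam z u) (gam z t) < eps.
Proof.
  intros Hl Hb1 Hb HA Hg Hz t eps Ht He. destruct (inv_lt_1 b Hb1) as [Hi0 Hi1].
  destruct (pow_small (/ b) A (eps / 3)) as [n Hn]; try lra. specialize (Hn n (le_n n)).
  destruct (hair_approx_continuous lam b n Hl Hb1 Hb z t (eps / 3) Hz Ht ltac:(lra)) as (d & Hd & Hc).
  exists d. split; [easy|]. intros u Hu Hut. specialize (Hc u Hu Hut).
  pose proof (Hg z u Hz Hu n) as H1. pose proof (Hg z t Hz Ht n) as H2. rewrite cdist_sym in H2.
  pose proof (cdist_triangle (gam z u) (hair_approx lam n z u) (gam z t)).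
  pose proof (cdist_triangle (hair_approx lam n z u) (hair_approx lam n z t) (gam z t)). lra.
Qed.

Lemma same_strip_Im (lam b : R) (z w : C) : 0 < lam -> 0 < b -> b <= Re (E lam z) -> b <= Re (E lam w) ->
  strip z = strip w -> Rabs (Im z - Im w) <= PI.
Proof.
  intros Hl Hb Hz Hw Hs.
  pose proof (strip_half z (cos_Im_pos lam z Hl ltac:(lra))) as Bz.
  pose proof (strip_half w (cos_Im_pos lam w Hl ltac:(lra))) as Bw.
  rewrite Hs in Bz. apply Rabs_def2 in Bz, Bw. apply Rabs_le. lra.
Qed.

(** At time n the parameter is the difference of real parts, leaving only an imaginary error of at
    most PI. Pulling back inverts the model maps and contracts that error. *)
Lemma hair_approx_hits (lam b : R) (n : nat) : 0 < lam -> 1 < b -> lam * exp b = b ->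
  forall z w, orbit_ge lam b z -> orbit_ge lam b w -> same_strips lam z w ->
  Re (Eiter lam n z) <= Re (Eiter lam n w) ->
  exists t, 0 <= t /\ cdist w (hair_approx lam n z t) <= PI * (/ b) ^ n.
Proof.
  intros Hl Hb1 Hb. induction n as [|n IH]; intros z w Hz Hw Hs Hle.
  - exists (Re w - Re z). cbn [Eiter Nat.iter] in Hle. split; [change (Re z <= Re w) in Hle; lra|].
    rewrite pow_O, Rmult_1_r. cbn [hair_approx].
    eapply Rle_trans; [apply cdist_le_sum|]. cbn [Re Im fst snd]. fold (Re z) (Re w) (Im z) (Im w).
    replace (Re w - (Re z + (Re w - Re z))) with 0 by ring. rewrite Rabs_R0, Rplus_0_l.
    apply (same_strip_Im lam b); try lra; [exact (Hw 1%nat) | exact (Hz 1%nat) |].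
    symmetry. exact (Hs 0%nat).
  - rewrite !Eiter_succ in Hle.
    pose proof (orbit_ge_E _ _ _ Hz) as HEz. pose proof (orbit_ge_E _ _ _ Hw) as HEw.
    destruct (IH _ _ HEz HEw (same_strips_E _ _ _ Hs) Hle) as (t' & Ht' & Hd).
    pose proof (Hz 1%nat : b <= Re (E lam z)) as H1. pose proof (Re_le_cabs (E lam z)) as H2.
    pose proof (Hw 1%nat : b <= Re (E lam w)) as H3.
    set (r := cabs (E lam z)) in *.
    assert (Htr : 0 <= t' / r) by (apply Rmult_le_pos; [easy | left; apply Rinv_0_lt_compat; lra]).
    exists (ln (1 + t' / r)). split.
    + rewrite <- ln_1. apply ln_le_mono; lra.
    + cbn [hair_approx]. fold r. rewrite exp_ln by lra.
      replace (r * (1 + t' / r - 1)) with t' by (field; lra).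
      rewrite <- (L_E lam w) at 1 by lra. replace (strip w) with (strip z) by exact (Hs 0%nat).
      pose proof (L_lipschitz lam b (strip z) (E lam w) (hair_approx lam n (E lam z) t') Hl ltac:(lra)
        H3 (hair_approx_Re lam b n Hl Hb _ _ HEz Ht')) as HL.
      apply (Rmult_le_reg_l b); [lra|]. cbn [pow].
      replace (b * (PI * (/ b * (/ b) ^ n))) with (PI * (/ b) ^ n) by (field; lra). lra.
Qed.

(** The approximate parameters are bounded, and continuity makes any cluster point of them an exact
    parameter of w. *)
Lemma hair_map_surjective (lam b A : R) (gam : C -> R -> C) (z w : C) (n0 : nat) :
  0 < lam -> 1 < b -> lam * exp b = b -> 0 <= A -> is_hair_map lam b A gam ->
  orbit_ge lam b z -> orbit_ge lam b w -> same_strips lam z w ->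
  (forall n, (n0 <= n)%nat -> Re (Eiter lam n z) <= Re (Eiter lam n w)) ->
  exists t, 0 <= t /\ gam z t = w.
Proof.
  intros Hl Hb1 Hb HA Hg Hz Hw Hs Hle. destruct (inv_lt_1 b Hb1) as [Hi0 Hi1]. pose proof PI_RGT_0 as HPI.
  destruct (functional_choice (fun (n : nat) t => 0 <= t /\ cdist w (gam z t) <= (PI + A) * (/ b) ^ n))
    as [tn Htn].
  (* Level n + n0 secures the order of real parts, and its error is no larger than at level n. *)
  { intros n. destruct (hair_approx_hits lam b (n + n0) Hl Hb1 Hb z w Hz Hw Hs) as (t & Ht & Hd).
    { apply Hle. lia. }
    exists t. split; [easy|]. pose proof (Hg z t Hz Ht (n + n0)%nat) as H1. rewrite cdist_sym in H1.
    pose proof (cdist_triangle w (hair_approx lam (n + n0) z t) (gam z t)) as H2.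
    assert ((/ b) ^ (n + n0) <= (/ b) ^ n).
    { rewrite pow_add. rewrite <- (Rmult_1_r ((/ b) ^ n)) at 2. apply Rmult_le_compat_l; [apply pow_le; lra|].
      rewrite <- (pow1 n0). apply pow_incr. lra. }
    nra. }
  (* A parameter is at most |gam z t - z| + A, and gam z t is within PI + A of w. *)
  set (M := cdist w z + PI + 2 * A).
  assert (Hbd : forall n, 0 <= tn n <= M).
  { intros n. destruct (Htn n) as [H0 H1]. split; [easy|].
    pose proof (hair_map_asymptotic lam b A gam z (tn n) Hg Hz H0) as H2. rewrite cdist_sym in H2.
    assert ((/ b) ^ n <= 1) by (rewrite <- (pow1 n); apply pow_incr; lra).
    pose proof (cdist_triangle z w (gam z (tn n))) as H4.
    pose proof (cdist_triangle z (gam z (tn n)) (Re z + tn n, Im z)) as H5.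
    rewrite (cdist_sym (gam z (tn n))) in H5. rewrite (cdist_sym z w) in H4.
    pose proof (Rabs_Re_le_cdist z (Re z + tn n, Im z)) as H6. cbn [Re fst] in H6. fold (Re z) in H6.
    rewrite Rabs_minus_sym in H6. pose proof (Rle_abs (Re z + tn n - Re z)). unfold M. nra. }
  destruct (Bolzano_Weierstrass tn (fun x => 0 <= x <= M) (compact_P3 0 M) Hbd) as [t Hadh].
  assert (Hclose : forall eps, 0 < eps -> forall N, exists p, (N <= p)%nat /\ Rabs (tn p - t) < eps).
  { intros eps He N. apply (Hadh (disc t (mkposreal eps He)) N).
    exists (mkposreal eps He). intros x Hx. exact Hx. }
  assert (Ht : 0 <= t).
  { apply Rnot_lt_le. intros Hneg. destruct (Hclose (- t) ltac:(lra) 0%nat) as (p & _ & Hp).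
    pose proof (Hbd p). pose proof (Rle_abs (tn p - t)). lra. }
  exists t. split; [easy|]. symmetry. apply cdist_le0_eq. apply le_epsilon. intros eps He.
  destruct (hair_map_continuous lam b A gam z Hl Hb1 Hb HA Hg Hz t (eps / 2) Ht ltac:(lra)) as (d & Hd & Hc).
  destruct (pow_small (/ b) (PI + A) (eps / 2)) as [N HN]; try lra.
  destruct (Hclose d Hd N) as (p & HpN & Hp). destruct (Htn p) as [Hp0 Hp1].
  specialize (Hc (tn p) Hp0 Hp). specialize (HN p HpN).
  pose proof (cdist_triangle w (gam z (tn p)) (gam z t)). lra.
Qed.

(** * Endpoints, and companions to the left on the same hair *)

Lemma itinerary_iff (lam : R) (z : C) (s : nat -> Z) :
  itinerary lam z s <-> forall j, strip (Eiter lam j z) = s j.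
Proof.
  split.
  - intros H j. destruct (H j). now apply strip_unique.
  - intros H j. rewrite <- H. apply strip_spec.
Qed.

Lemma hair_iff (lam : R) (z w : C) : hair lam z w <-> Julia lam w /\ same_strips lam z w.
Proof.
  unfold hair. split; intros [HJ H]; (split; [easy|]).
  - destruct H as (s & Hz & Hw). rewrite itinerary_iff in Hz, Hw. intros n. congruence.
  - exists (fun n => strip (Eiter lam n z)). rewrite !itinerary_iff. split; [easy|].
    intros j. symmetry. apply H.
Qed.

Lemma endpoint_of_minimal (lam a b : R) (z : C) :
  0 < lam -> lam < exp (-1) -> 0 < a -> a < 1 -> 1 < b -> lam * exp a = a -> lam * exp b = b ->
  orbit_ge lam b z ->
  (forall w, orbit_ge lam b w -> same_strips lam z w ->
     exists n0, forall n, (n0 <= n)%nat -> Re (Eiter lam n z) <= Re (Eiter lam n w)) ->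
  endpoint lam z.
Proof.
  intros Hl Hl1 Ha0 Ha1 Hb1 Ha Hb Hz Hmin.
  destruct (hair_map_exists lam b Hl Hb1 Hb) as (A & gam & HA & Hg).
  split; [now apply (Re_ge_Julia lam a b)|].
  exists (gam z). split; [|split; [|split; [|split]]].
  - symmetry. apply cdist_le0_eq. destruct (inv_lt_1 b Hb1) as [Hi0 Hi1].
    apply (le_of_pow _ A (/ b)); try lra. intros n.
    rewrite cdist_sym. rewrite <- (hair_approx_0 lam b n Hl Hb1 z Hz) at 2. apply Hg; [easy|lra].
  - now apply (hair_map_continuous lam b A).
  - intros t u Ht Hu Heq. destruct (Rtotal_order t u) as [H|[H|H]]; [|easy|].
    + now destruct (hair_map_injective lam b A gam z t u Hl Hb1 Hb HA Hg Hz Ht H).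
    + now destruct (hair_map_injective lam b A gam z u t Hl Hb1 Hb HA Hg Hz Hu H).
  - intros M. exists (Rabs M + A). intros t Ht. pose proof (Rabs_pos M). pose proof (Rle_abs M).
    pose proof (hair_map_asymptotic lam b A gam z t Hg Hz ltac:(lra)) as H1.
    pose proof (Rabs_Re_le_cdist (gam z t) (Re z + t, Im z)) as H2. cbn [Re fst] in H2.
    fold (Re z) (Re (gam z t)) in H2. rewrite Rabs_minus_sym in H2.
    pose proof (Rle_abs (Re z + t - Re (gam z t))). pose proof (Re_le_cabs (gam z t)).
    pose proof (Hz 0%nat : b <= Re z). lra.
  - intros w. rewrite hair_iff. split.
    + intros [HJ Hs]. assert (Hw : orbit_ge lam b w) by (intros n; now apply (Julia_Re_ge lam a b)).
      destruct (Hmin w Hw Hs) as [n0 Hn0]. now apply (hair_map_surjective lam b A gam z w n0).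
    + intros (t & Ht & <-). destruct (hair_map_in_hair lam b A gam z t) as [H1 H2]; try assumption.
      split; [now apply (Re_ge_Julia lam a b)|easy].
Qed.

Lemma hair_separation (lam b : R) (z w : C) : 0 < lam -> 1 < b -> orbit_ge lam b z -> orbit_ge lam b w ->
  same_strips lam z w -> forall n, b ^ n * cdist z w <= cdist (Eiter lam n z) (Eiter lam n w).
Proof.
  intros Hl Hb1 Hz Hw Hs. induction n as [|n IH]; [cbn; lra|].
  pose proof (E_expand lam b (Eiter lam n z) (Eiter lam n w) Hl ltac:(lra) (Hs n) (Hz (S n)) (Hw (S n))) as H.
  change (E lam (Eiter lam n z)) with (Eiter lam (S n) z) in H.
  change (E lam (Eiter lam n w)) with (Eiter lam (S n) w) in H.
  cbn [pow]. rewrite Rmult_assoc. apply (Rmult_le_compat_l b) in IH; lra.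
Qed.

(** A gap of 6 gives |E z| >= 7 |E w|. As the imaginary parts differ by at most PI and |E w| > 1,
    this excess cannot be imaginary. *)
Lemma order_persists (lam b : R) (z w : C) : 0 < lam -> 1 < b ->
  b <= Re (E lam z) -> b <= Re (E lam w) -> Rabs (Im (E lam z) - Im (E lam w)) <= PI ->
  6 <= Re z - Re w -> Re (E lam w) < Re (E lam z).
Proof.
  intros Hl Hb1 Hz Hw HI HD. apply Rnot_le_lt. intros Hle.
  pose proof (cabs_E lam z Hl) as H1. pose proof (cabs_E lam w Hl) as H2.
  assert (H3 : cabs (E lam z) = exp (Re z - Re w) * cabs (E lam w)).
  { rewrite H1, H2. replace (Re z) with (Re z - Re w + Re w) at 1 by ring. rewrite exp_plus. ring. }
  assert (H4 : 7 <= exp (Re z - Re w)).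
  { pose proof (exp_ineq1_le (Re z - Re w)). lra. }
  pose proof (cabs_le_sum (E lam z)) as H5. pose proof (Rabs_Im_le_cabs (E lam w)) as H6.
  pose proof (Re_le_cabs (E lam w)) as H7. rewrite (Rabs_right (Re (E lam z))) in H5 by lra.
  assert (H8 : Rabs (Im (E lam z)) <= Rabs (Im (E lam w)) + PI).
  { replace (Im (E lam z)) with (Im (E lam z) - Im (E lam w) + Im (E lam w)) by ring.
    pose proof (Rabs_triang (Im (E lam z) - Im (E lam w)) (Im (E lam w))). lra. }
  pose proof PI_4. nra.
Qed.

(** If no companion exists, every w of the hair is eventually to the right of z, which makes z an
    endpoint by [endpoint_of_minimal]. *)
Lemma lower_companion (lam a b : R) (z : C) :
  0 < lam -> lam < exp (-1) -> 0 < a -> a < 1 -> 1 < b -> lam * exp a = a -> lam * exp b = b ->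
  orbit_ge lam b z -> ~ endpoint lam z ->
  exists c, orbit_ge lam b c /\ same_strips lam z c /\
    forall M, exists N : nat, forall n, (N <= n)%nat -> M <= Re (Eiter lam n z) - Re (Eiter lam n c).
Proof.
  intros Hl Hl1 Ha0 Ha1 Hb1 Ha Hb Hz Hend. apply NNPP. intros Hno. apply Hend.
  apply (endpoint_of_minimal lam a b); try assumption. intros w Hw Hs.
  destruct (classic (z = w)) as [<-|Hne]; [exists 0%nat; intros; lra|].
  assert (Hd0 : 0 < cdist z w).
  { apply Rnot_le_lt. intros H. now apply Hne, cdist_le0_eq. }
  assert (HI : forall n, Rabs (Im (Eiter lam n z) - Im (Eiter lam n w)) <= PI).
  { intros n. apply (same_strip_Im lam b); try lra; [exact (Hz (S n)) | exact (Hw (S n)) | apply Hs]. }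
  (* Orbits on one hair separate at least like b^n, and the imaginary parts do not contribute more
     than PI. *)
  assert (HD : forall M, exists N : nat, forall n, (N <= n)%nat -> M <= Rabs (Re (Eiter lam n z) - Re (Eiter lam n w))).
  { intros M. destruct (pow_unbounded b (cdist z w) (M + PI) Hb1 Hd0) as [N HN]. exists N. intros n Hn.
    specialize (HN n Hn). pose proof (hair_separation lam b z w Hl Hb1 Hz Hw Hs n).
    pose proof (cdist_le_sum (Eiter lam n z) (Eiter lam n w)). specialize (HI n). lra. }
  (* From [N] on the gap is at least 6, so the order at time [N] is kept for ever. *)
  destruct (HD 6) as [N HN].
  destruct (Rle_dec (Re (Eiter lam N z)) (Re (Eiter lam N w))) as [Hle|Hgt].
  - exists N. intros n Hn. induction Hn as [|n Hn IH]; [easy|].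
    left. apply (order_persists lam b (Eiter lam n w) (Eiter lam n z)); try assumption; [apply (Hw (S n)) | apply (Hz (S n)) | |].
    + rewrite Rabs_minus_sym. apply (HI (S n)).
    + specialize (HN n Hn). rewrite Rabs_left1 in HN; lra.
  - exfalso. apply Hno. exists w. split; [easy|]. split; [easy|]. intros M.
    destruct (HD M) as [N' HN']. exists (N + N')%nat. intros n Hn.
    assert (Hpos : Re (Eiter lam n w) < Re (Eiter lam n z)).
    { assert (Hn' : (N <= n)%nat) by lia. clear Hn. induction Hn' as [|n Hn IH]; [lra|].
      apply (order_persists lam b (Eiter lam n z) (Eiter lam n w)); try assumption;
        [apply (Hz (S n)) | apply (Hw (S n)) | apply (HI (S n)) |].
      specialize (HN n Hn). cbv beta in *. rewrite Rabs_right in HN; lra. }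
    specialize (HN' n ltac:(lia)). rewrite Rabs_right in HN'; lra.
Qed.

(** * Orbits with small imaginary parts *)

(** As |E^(n+1) z| = lam exp (Re E^n z), the bound puts the imaginary part at the order of the
    square root of the modulus. *)
Definition tame (lam M0 : R) (z : C) : Prop := forall n,
  M0 <= Re (Eiter lam n z) /\ Rabs (Im (Eiter lam (S n) z)) <= exp (Re (Eiter lam n z) / 2).

Lemma eventually_tame (lam b M0 : R) (z c : C) : 0 < lam -> lam < 1 -> 1 < b ->
  orbit_ge lam b z -> orbit_ge lam b c -> same_strips lam z c ->
  (forall M, exists N : nat, forall n, (N <= n)%nat -> M <= Re (Eiter lam n z) - Re (Eiter lam n c)) ->
  exists N, tame lam M0 (Eiter lam N z).
Proof.
  intros Hl Hl1 Hb1 Hz Hc Hs Hfar.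
  destruct (Hfar (Rmax M0 16)) as [N HN]. exists (S N).
  assert (HR : forall n, (N <= n)%nat -> M0 <= Re (Eiter lam n z) /\ 16 <= Re (Eiter lam n z)).
  { intros n Hn. specialize (HN n Hn). specialize (Hc n). pose proof (Rmax_l M0 16). pose proof (Rmax_r M0 16). lra. }
  assert (HIm : forall n, Rabs (Im (Eiter lam n z)) <= 5 * cabs (Eiter lam n c)).
  { intros n.
    pose proof (same_strip_Im lam b (Eiter lam n z) (Eiter lam n c) Hl ltac:(lra) (Hz (S n)) (Hc (S n)) (Hs n)) as H1.
    pose proof (Rabs_Im_le_cabs (Eiter lam n c)). pose proof (Re_le_cabs (Eiter lam n c)).
    specialize (Hc n).
    replace (Im (Eiter lam n z)) with (Im (Eiter lam n z) - Im (Eiter lam n c) + Im (Eiter lam n c)) by ring.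
    pose proof (Rabs_triang (Im (Eiter lam n z) - Im (Eiter lam n c)) (Im (Eiter lam n c))).
    pose proof PI_4. lra. }
  (* The gap of 16 gives |z_(n+1)| >= 17 |c_(n+1)|, of which the imaginary part accounts for at most
     5 |c_(n+1)|. *)
  assert (Hbig : forall n, (N <= n)%nat -> 4 * cabs (Eiter lam (S n) c) <= Re (Eiter lam (S n) z)).
  { intros n Hn. pose proof (HIm (S n)) as H1. pose proof (HR n Hn) as H2.
    pose proof (cabs_le_sum (Eiter lam (S n) z)) as H3.
    rewrite (Rabs_right (Re (Eiter lam (S n) z))) in H3 by (pose proof (Hz (S n)); lra).
    assert (H4 : cabs (Eiter lam (S n) z) = exp (Re (Eiter lam n z) - Re (Eiter lam n c)) * cabs (Eiter lam (S n) c)).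
    { change (Eiter lam (S n) z) with (E lam (Eiter lam n z)). change (Eiter lam (S n) c) with (E lam (Eiter lam n c)).
      rewrite !cabs_E by easy.
      replace (Re (Eiter lam n z)) with (Re (Eiter lam n z) - Re (Eiter lam n c) + Re (Eiter lam n c)) at 1 by ring.
      rewrite exp_plus. ring. }
    pose proof (exp_ineq1_le (Re (Eiter lam n z) - Re (Eiter lam n c))) as H5.
    specialize (HN n Hn). pose proof (Rmax_r M0 16). pose proof (cabs_nonneg (Eiter lam (S n) c)).
    rewrite H4 in H3.
    pose proof (Rmult_le_compat_r (cabs (Eiter lam (S n) c)) 17 (exp (Re (Eiter lam n z) - Re (Eiter lam n c)))
      ltac:(lra) ltac:(lra)). lra. }
  intros n. rewrite <- !Eiter_add. set (k := (n + N)%nat).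
  replace (n + S N)%nat with (S k) by (unfold k; lia). replace (S n + S N)%nat with (S (S k)) by (unfold k; lia).
  split; [apply HR; unfold k; lia|].
  pose proof (HIm (S (S k))) as H1. pose proof (Hbig k ltac:(unfold k; lia)) as H2.
  pose proof (proj2 (HR (S k) ltac:(unfold k; lia))) as H3.
  change (Eiter lam (S (S k)) c) with (E lam (Eiter lam (S k) c)) in H1. rewrite cabs_E in H1 by easy.
  set (x := Re (Eiter lam (S k) z)) in *. pose proof (Re_le_cabs (Eiter lam (S k) c)).
  (* The factor 5 from [HIm] is absorbed by exp (x/4) >= 1 + x/4 >= 5, since x >= 16. *)
  assert (H4 : exp (Re (Eiter lam (S k) c)) <= exp (x / 4)) by (apply exp_le_mono; lra).
  replace (x / 2) with (x / 4 + x / 4) by field. rewrite exp_plus.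
  pose proof (exp_ineq1_le (x / 4)). pose proof (exp_pos (Re (Eiter lam (S k) c))).
  apply Rle_trans with (1 := H1). nra.
Qed.

(** ** Covers *)

Definition log_gauge (d : R) : R := d / ln (/ d).

Definition weight (l : list ((C -> Prop) * R)) : R :=
  fold_right (fun p s => log_gauge (snd p) + s) 0 l.

(** Each listed number only bounds the diameter of its set, and it is positive so that [log_gauge]
    can be estimated. *)
Definition covered (A : C -> Prop) (eta S : R) : Prop :=
  exists l : list ((C -> Prop) * R),
    (forall p, In p l -> 0 < snd p /\ snd p <= eta /\
       forall z w, fst p z -> fst p w -> cdist z w <= snd p) /\
    (forall z, A z -> exists p, In p l /\ fst p z) /\
    weight l <= S.

Lemma weight_app (l l' : list ((C -> Prop) * R)) : weight (l ++ l') = weight l + weight l'.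
Proof. unfold weight. induction l as [|p l IH]; cbn in *; [ring|]. rewrite IH. ring. Qed.

Lemma covered_mono (A B : C -> Prop) (eta eta' S S' : R) : (forall z, A z -> B z) ->
  eta <= eta' -> S <= S' -> covered B eta S -> covered A eta' S'.
Proof.
  intros HAB He HS (l & H1 & H2 & H3). exists l. split; [|split; [auto|lra]].
  intros p Hp. destruct (H1 p Hp) as (H4 & H5 & H6). repeat split; auto; lra.
Qed.

Lemma covered_single (A : C -> Prop) (d : R) : 0 < d ->
  (forall z w, A z -> A w -> cdist z w <= d) -> covered A d (log_gauge d).
Proof.
  intros Hd HA. exists ((A, d) :: nil). split; [|split].
  - intros p [<-|[]]. cbn [fst snd]. split; [easy|]. split; [lra|easy].
  - intros z Hz. exists (A, d). split; [now left|easy].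
  - cbn. lra.
Qed.

Lemma covered_finite_union {I : Type} (idx : list I) (A : I -> C -> Prop) (eta S : R) :
  (forall i, In i idx -> covered (A i) eta S) ->
  covered (fun z => exists i, In i idx /\ A i z) eta (INR (length idx) * S).
Proof.
  induction idx as [|i idx IH]; intros H.
  - exists nil. split; [intros p []|]. split; [intros z (i & [] & _)|]. cbn. lra.
  - destruct (H i (or_introl eq_refl)) as (l & H1 & H2 & H3).
    destruct IH as (l' & H1' & H2' & H3'); [intros j Hj; apply H; now right|].
    exists (l ++ l'). split; [|split].
    + intros p Hp. apply in_app_or in Hp. destruct Hp; auto.
    + intros z (j & [<-|Hj] & Hz).
      * destruct (H2 z Hz) as (p & Hp & Hpz). exists p. split; [apply in_or_app; auto|easy].
      * destruct (H2' z (ex_intro _ j (conj Hj Hz))) as (p & Hp & Hpz).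
        exists p. split; [apply in_or_app; auto|easy].
    + rewrite weight_app. cbn [length]. rewrite S_INR. lra.
Qed.

Lemma ln_inv_pos (d : R) : 0 < d -> d < 1 -> 0 < ln (/ d).
Proof.
  intros H0 H1. rewrite <- ln_1. apply ln_increasing; [lra|].
  rewrite <- Rinv_1. apply Rinv_lt_contravar; lra.
Qed.

Lemma log_gauge_pos (d : R) : 0 < d -> d < 1 -> 0 < log_gauge d.
Proof. intros H0 H1. apply Rdiv_lt_0_compat; [easy|]. now apply ln_inv_pos. Qed.

Lemma log_gauge_div (d X : R) : 0 < d -> d < 1 -> 1 <= X -> log_gauge (d / X) <= log_gauge d / X.
Proof.
  intros H0 H1 HX. unfold log_gauge. pose proof (ln_inv_pos d H0 H1).
  assert (HdX : 0 < d / X) by (apply Rdiv_lt_0_compat; lra).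
  assert (Hle : ln (/ d) <= ln (/ (d / X))).
  { apply ln_le_mono; [now apply Rinv_0_lt_compat|]. apply Rinv_le_contravar; [easy|].
    apply (Rmult_le_reg_r X); [lra|]. unfold Rdiv. rewrite Rmult_assoc, Rinv_l by lra. nra. }
  replace (d / ln (/ d) / X) with (d / X / ln (/ d)) by (field; lra).
  apply Rmult_le_compat_l; [lra|]. apply Rinv_le_contravar; lra.
Qed.

(** E expands A by at least X within one strip, so a single branch is involved: the number of sets
    is unchanged, diameters shrink by X, and [log_gauge_div] handles the weights. *)
Lemma covered_pullback (lam X eta S : R) (A B : C -> Prop) : 0 < lam -> 1 <= X -> eta < 1 ->
  (forall z, A z -> B (E lam z) /\ X <= Re (E lam z)) ->
  (forall z w, A z -> A w -> strip z = strip w) ->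
  covered B eta S -> covered A (eta / X) (S / X).
Proof.
  intros Hl HX He HA Hs (l & H1 & H2 & H3).
  assert (Hdiv : forall x y, x <= y -> x / X <= y / X).
  { intros x y Hxy. apply Rmult_le_compat_r; [left; apply Rinv_0_lt_compat; lra | easy]. }
  exists (map (fun p => (fun z => A z /\ fst p (E lam z), snd p / X)) l). split; [|split].
  - intros p Hp. apply in_map_iff in Hp. destruct Hp as (q & <- & Hq). cbn [fst snd].
    destruct (H1 q Hq) as (Hq0 & Hq1 & Hq2). split; [apply Rdiv_lt_0_compat; lra|].
    split; [now apply Hdiv|]. intros z w [Az Bz] [Aw Bw].
    pose proof (E_expand lam X z w Hl ltac:(lra) (Hs z w Az Aw) (proj2 (HA z Az)) (proj2 (HA w Aw))).
    specialize (Hq2 _ _ Bz Bw).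
    apply (Rmult_le_reg_l X); [lra|]. replace (X * (snd q / X)) with (snd q) by (field; lra). lra.
  - intros z Az. destruct (H2 _ (proj1 (HA z Az))) as (p & Hp & Hpz).
    eexists. split; [apply in_map, Hp|]. now split.
  - apply Rle_trans with (weight l / X); [|now apply Hdiv]. clear H2 H3.
    induction l as [|q l IH]; [cbn; lra|].
    destruct (H1 q (or_introl eq_refl)) as (Hq0 & Hq1 & _).
    specialize (IH (fun p Hp => H1 p (or_intror Hp))).
    cbn [map weight fold_right fst snd] in *.
    pose proof (log_gauge_div (snd q) X Hq0 ltac:(lra) HX). fold (weight l).
    unfold weight in *. lra.
Qed.

Lemma grid (a p sg : R) : 0 < sg -> 0 <= p -> exists k : nat, INR k <= p / sg + 1 /\
  forall x, a <= x -> x <= a + p -> exists i, (i < k)%nat /\ a + INR i * sg <= x /\ x <= a + INR i * sg + sg.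
Proof.
  intros Hs Hp.
  assert (Hps : 0 <= p / sg) by (apply Rmult_le_pos; [easy | left; now apply Rinv_0_lt_compat]).
  assert (Hfl : forall y, 0 <= y -> exists i : nat, INR i <= y /\ y < INR i + 1).
  { intros y Hy. destruct (archimed y) as [H1 H2]. exists (Z.to_nat (up y - 1)).
    assert (0 <= up y - 1)%Z by (assert (0 < up y)%Z by (apply lt_IZR; lra); lia).
    rewrite INR_IZR_INZ, Z2Nat.id, minus_IZR by easy. lra. }
  destruct (Hfl _ Hps) as (k & Hk1 & Hk2). exists (S k). rewrite S_INR. split; [lra|].
  intros x H1 H2. destruct (Hfl ((x - a) / sg)) as (i & Hi1 & Hi2).
  { apply Rmult_le_pos; [lra | left; now apply Rinv_0_lt_compat]. }
  exists i.
  assert (Hx : (x - a) / sg * sg = x - a) by (field; lra).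
  assert (Hpp : p / sg * sg = p) by (field; lra).
  split; [|split].
  - apply INR_lt. rewrite S_INR. apply (Rmult_lt_reg_r sg); nra.
  - nra.
  - nra.
Qed.

(** Applied with f = E: the squares lie in the image, while the sets being covered lie in the
    source. Cells start at x >= a, which preserves the lower bound on the expansion. *)
Lemma grid_cover (A : C -> Prop) (f : C -> C) (a p b q sg eta S : R) :
  0 < sg -> 0 <= p -> 0 <= q -> 0 <= S ->
  (forall z, A z -> a <= Re (f z) <= a + p /\ b <= Im (f z) <= b + q) ->
  (forall x y, a <= x -> covered (fun z => A z /\ x <= Re (f z) <= x + sg /\ y <= Im (f z) <= y + sg) eta S) ->
  covered A eta ((p / sg + 1) * (q / sg + 1) * S).
Proof.
  intros Hs Hp Hq HS HA Hcell.
  destruct (grid a p sg Hs Hp) as (k1 & Hk1 & Hg1). destruct (grid b q sg Hs Hq) as (k2 & Hk2 & Hg2).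
  set (cell := fun (ij : nat * nat) z => A z /\
    a + INR (fst ij) * sg <= Re (f z) <= a + INR (fst ij) * sg + sg /\
    b + INR (snd ij) * sg <= Im (f z) <= b + INR (snd ij) * sg + sg).
  apply (covered_mono _ (fun z => exists ij, In ij (list_prod (seq 0 k1) (seq 0 k2)) /\ cell ij z)
    eta _ (INR (length (list_prod (seq 0 k1) (seq 0 k2))) * S)); [| lra | |].
  - intros z Az. destruct (HA z Az) as [[R1 R2] [I1 I2]].
    destruct (Hg1 _ R1 R2) as (i & Hi & Hi1 & Hi2). destruct (Hg2 _ I1 I2) as (j & Hj & Hj1 & Hj2).
    exists (i, j). split; [apply in_prod; apply in_seq; lia|]. unfold cell. cbn [fst snd]. tauto.
  - rewrite length_prod, !length_seq, mult_INR. apply Rmult_le_compat_r; [easy|].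
    pose proof (pos_INR k1); pose proof (pos_INR k2). apply Rmult_le_compat; lra.
  - apply covered_finite_union. intros [i j] _. apply Hcell. cbn [fst].
    pose proof (pos_INR i). nra.
Qed.

(** * Recursive covers of unit boxes *)

Definition tame_box (lam M0 m l : R) (z : C) : Prop :=
  tame lam M0 z /\ m <= Re z <= m + 1 /\ l <= Im z <= l + 1.

Lemma tame_E (lam M0 : R) (z : C) : tame lam M0 z -> tame lam M0 (E lam z).
Proof. intros H n. rewrite <- !Eiter_succ. apply H. Qed.

(** The middle halves of different strips are at least PI apart, more than the height 1 of the
    box. *)
Lemma tame_box_strip (lam M0 m l : R) (z w : C) : 0 < lam -> 0 < M0 ->
  tame_box lam M0 m l z -> tame_box lam M0 m l w -> strip z = strip w.
Proof.
  intros Hl HM (Tz & _ & Iz) (Tw & _ & Iw).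
  pose proof (proj1 (Tz 1%nat) : M0 <= Re (E lam z)). pose proof (proj1 (Tw 1%nat) : M0 <= Re (E lam w)).
  pose proof (strip_half z (cos_Im_pos lam z Hl ltac:(lra))) as Bz.
  pose proof (strip_half w (cos_Im_pos lam w Hl ltac:(lra))) as Bw.
  apply Rabs_def2 in Bz, Bw. pose proof PI2_1.
  assert (IZR (strip z) < IZR (strip w + 1)) by (rewrite plus_IZR; nra).
  assert (IZR (strip w) < IZR (strip z + 1)) by (rewrite plus_IZR; nra).
  apply lt_IZR in H2, H3. lia.
Qed.

(** With u = exp (m/2), |E z| lies between lam u^2 and 3 lam u^2 (as e <= 3) and |Im (E z)| <= 2 u.
    Removing 2 u from the modulus leaves Re (E z) >= lam u^2 / 2, because 4 <= lam u. *)
Lemma tame_box_image (lam M0 m l : R) (z : C) : 0 < lam -> 0 < M0 -> 4 <= lam * exp (m / 2) ->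
  tame_box lam M0 m l z ->
  lam * (exp (m / 2) * exp (m / 2)) / 2 <= Re (E lam z) <=
    lam * (exp (m / 2) * exp (m / 2)) / 2 + 3 * lam * (exp (m / 2) * exp (m / 2)) /\
  - (2 * exp (m / 2)) <= Im (E lam z) <= - (2 * exp (m / 2)) + 4 * exp (m / 2).
Proof.
  intros Hl HM Hu (Tz & [R1 R2] & _). pose proof (proj2 (Tz 0%nat)) as HI.
  change (Eiter lam 1 z) with (E lam z) in HI. change (Eiter lam 0 z) with z in HI.
  pose proof (cabs_E lam z Hl) as Habs. set (u := exp (m / 2)) in *.
  assert (Hu0 : 0 < u) by apply exp_pos.
  assert (Hm : exp m = u * u) by (unfold u; rewrite <- exp_plus; f_equal; field).
  assert (Hlo : u * u <= exp (Re z)) by (rewrite <- Hm; now apply exp_le_mono).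
  assert (Hhi : exp (Re z) <= 3 * (u * u)).
  { rewrite <- Hm. apply Rle_trans with (exp (m + 1)); [now apply exp_le_mono|].
    rewrite exp_plus. pose proof exp_le_3. pose proof (exp_pos m). nra. }
  assert (HI2 : exp (Re z / 2) <= 2 * u).
  { apply Rle_trans with (exp (m / 2 + 1 / 2)); [apply exp_le_mono; lra|].
    rewrite exp_plus. fold u.
    assert (exp (1 / 2) * exp (1 / 2) <= 3).
    { rewrite <- exp_plus. replace (1 / 2 + 1 / 2) with 1 by field. apply exp_le_3. }
    pose proof (exp_pos (1 / 2)). assert (exp (1 / 2) <= 2) by nra. nra. }
  pose proof (cabs_le_sum (E lam z)) as Hsum. pose proof (Re_le_cabs (E lam z)).
  assert (HRe : M0 <= Re (E lam z)) by exact (proj1 (Tz 1%nat)).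
  assert (Hll : lam * (u * u) <= lam * exp (Re z)) by (apply Rmult_le_compat_l; lra).
  assert (Hlh : lam * exp (Re z) <= lam * (3 * (u * u))) by (apply Rmult_le_compat_l; lra).
  pose proof (Rle_abs (Im (E lam z))) as I1. pose proof (Rle_abs (- Im (E lam z))) as I2.
  rewrite Rabs_Ropp in I2.
  assert (Huu : 4 * u <= lam * (u * u)) by nra.
  rewrite (Rabs_right (Re (E lam z))) in Hsum by lra.
  split; split; nra.
Qed.

Lemma exp_half_ge (m : R) : 0 <= m -> m * m / 16 <= exp (m / 2).
Proof.
  intros Hm. replace (m / 2) with (m / 4 + m / 4) by field. rewrite exp_plus.
  pose proof (exp_ineq1_le (m / 4)). nra.
Qed.

Lemma tame_box_base (lam M0 m l : R) : 0 < lam -> lam < 1 -> 0 < M0 -> 1 <= m ->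
  16 <= lam * lam * exp (m / 2) -> covered (tame_box lam M0 m l) (1 / 4) (320 / lam / m).
Proof.
  intros Hl Hl1 HM Hm Hu. set (u := exp (m / 2)) in *. assert (Hu0 : 0 < u) by apply exp_pos.
  assert (Hlu : 16 <= lam * u) by nra.
  assert (Hu1 : 16 <= u) by nra.
  (* Diameter bound 2 u of an image square divided by the expansion factor lam u^2 / 2. *)
  set (d := 4 / (lam * u)).
  assert (Hd0 : 0 < d) by (apply Rdiv_lt_0_compat; lra).
  assert (Hd : d * (lam * u) = 4) by (unfold d; field; split; lra).
  assert (Hd1 : d <= 1 / 4) by nra.
  assert (Hg : log_gauge d <= d * (4 / m)).
  { unfold log_gauge. apply Rmult_le_compat_l; [lra|].
    (* 1/d = lam u / 4 is at least the square root exp (m/4) of u, because lam^2 u >= 16. *)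
    assert (Hln : m / 4 <= ln (/ d)).
    { rewrite <- (ln_exp (m / 4)). apply ln_le_mono; [apply exp_pos|].
      unfold d. rewrite Rinv_div. pose proof (exp_pos (m / 4)).
      assert (He : exp (m / 4) * exp (m / 4) = u).
      { unfold u. rewrite <- exp_plus. f_equal. field. }
      set (r := exp (m / 4)) in *.
      assert (Hlr : 4 <= lam * r).
      { apply Rsqr_incr_0_var; [|nra]. unfold Rsqr. replace (lam * r * (lam * r)) with (lam * lam * (r * r)) by ring.
        rewrite He. lra. }
      apply (Rmult_le_reg_l 4); [lra|]. replace (4 * (lam * u / 4)) with (lam * u) by field.
      rewrite <- He. nra. }
    replace (4 / m) with (/ (m / 4)) by (field; lra). apply Rinv_le_contravar; lra. }
  assert (HX : 0 < lam * (u * u) / 2) by nra.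
  apply (covered_mono _ (tame_box lam M0 m l) d _
    ((3 * lam * (u * u) / u + 1) * (4 * u / u + 1) * log_gauge d)); [auto|lra| |].
  - replace (3 * lam * (u * u) / u) with (3 * (lam * u)) by (field; lra).
    replace (4 * u / u) with 4 by (field; lra).
    (* At most 4 u times 5 squares; 20 u * 4 / (lam u) * 4 / m is the bound 320 / lam / m. *)
    apply Rle_trans with (20 * u * (d * (4 / m))).
    + pose proof (log_gauge_pos d Hd0 ltac:(lra)).
      apply Rmult_le_compat; nra.
    + unfold d. right. field. repeat split; lra.
  - apply (grid_cover _ (E lam) (lam * (u * u) / 2) _ (- (2 * u))); try lra; try nra.
    + pose proof (log_gauge_pos d Hd0 ltac:(lra)). lra.
    + intros z Hz. apply (tame_box_image lam M0 m l); try easy. fold u. lra.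
    + intros x y Hx. apply covered_single; [easy|].
      intros z w (Bz & [Rz1 Rz2] & [Iz1 Iz2]) (Bw & [Rw1 Rw2] & [Iw1 Iw2]).
      pose proof (E_expand lam _ z w Hl HX (tame_box_strip lam M0 m l z w Hl HM Bz Bw)
        ltac:(lra) ltac:(lra)) as H.
      assert (Hdist : cdist (E lam z) (E lam w) <= 2 * u).
      { eapply Rle_trans; [apply cdist_le_sum|].
        assert (Rabs (Re (E lam z) - Re (E lam w)) <= u) by (apply Rabs_le; lra).
        assert (Rabs (Im (E lam z) - Im (E lam w)) <= u) by (apply Rabs_le; lra). lra. }
      apply (Rmult_le_reg_l (lam * (u * u) / 2)); [easy|].
      replace (lam * (u * u) / 2 * d) with (2 * u) by (unfold d; field; lra). lra.
Qed.

Lemma tame_box_covered (lam : R) (n : nat) : 0 < lam -> lam < 1 -> forall m l, 2560 / (lam * lam) <= m ->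
  covered (tame_box lam (2560 / (lam * lam)) m l) (1 / 4 * (1 / 2) ^ n) (320 / lam / m * (1 / 2) ^ n).
Proof.
  intros Hl Hl1. assert (Hll : 0 < lam * lam) by nra. set (M0 := 2560 / (lam * lam)).
  assert (HM0 : M0 * (lam * lam) = 2560) by (unfold M0; field; lra).
  assert (HM : 0 < M0) by (apply Rdiv_lt_0_compat; lra).
  assert (HM1 : 2560 <= M0) by nra.
  (* Both cases rest on 160 m <= lam^2 u. It follows from u >= m^2 / 16 and lam^2 m >= 2560, whence
     the threshold. *)
  induction n as [|n IH]; intros m l Hm; set (u := exp (m / 2));
    (assert (Hum : 160 * m <= lam * lam * u);
     [ pose proof (exp_half_ge m ltac:(lra)) as He; fold u in He;
       apply Rle_trans with (lam * lam * (m * m / 16)); [|apply Rmult_le_compat_l; lra];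
       assert (2560 <= lam * lam * m) by nra; nra |]).
  - rewrite !pow_O, !Rmult_1_r. apply tame_box_base; try lra. fold u. lra.
  - assert (Hu0 : 0 < u) by apply exp_pos.
    assert (Hlu : 160 * m <= lam * u) by nra.
    assert (Hu1 : 160 * m <= u) by nra.
    set (X := lam * (u * u) / 2).
    assert (HXm : m <= X) by (unfold X; nra).
    pose proof (pow_lt (1 / 2) n ltac:(lra)) as Hp. set (p := (1 / 2) ^ n) in *.
    cbn [pow]. fold p.
    assert (Hp1 : p <= 1) by (pose proof (pow_incr (1 / 2) 1 n ltac:(lra)) as H1; rewrite pow1 in H1; exact H1).
    (* Weight of one image box at real part X, divided by the expansion X. The 20 u^3 boxes
       contribute the factor 20 u^3 / X^2 = 80 / (lam^2 u) <= 1 / (2 m), half of the 1/m in the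
       claim. *)
    set (S0 := 320 / lam / X * p / X).
    assert (HS0 : 0 <= S0).
    { unfold S0. apply Rmult_le_pos; [|left; apply Rinv_0_lt_compat; lra].
      apply Rmult_le_pos; [|lra]. left. apply Rdiv_lt_0_compat; [apply Rdiv_lt_0_compat|]; lra. }
    apply (covered_mono _ (tame_box lam M0 m l) (1 / 4 * p / X) _
      ((3 * lam * (u * u) / 1 + 1) * (4 * u / 1 + 1) * S0)); [auto| | |].
    + apply (Rmult_le_reg_r X); [lra|]. replace (1 / 4 * p / X * X) with (1 / 4 * p) by (field; lra). nra.
    + apply Rle_trans with (20 * (u * u * u) * S0).
      * apply Rmult_le_compat_r; [easy|].
        assert (3 * lam * (u * u) / 1 + 1 <= 4 * (u * u)) by nra.
        assert (4 * u / 1 + 1 <= 5 * u) by lra.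
        replace (20 * (u * u * u)) with (4 * (u * u) * (5 * u)) by ring.
        apply Rmult_le_compat; nra.
      * unfold S0, X. replace (20 * (u * u * u) * (320 / lam / (lam * (u * u) / 2) * p / (lam * (u * u) / 2)))
          with (320 / lam * p * (80 / (lam * lam * u))) by (field; lra).
        replace (320 / lam / m * (1 / 2 * p)) with (320 / lam * p * (1 / (2 * m))) by (field; lra).
        apply Rmult_le_compat_l.
        { apply Rmult_le_pos; [left; apply Rdiv_lt_0_compat|]; lra. }
        apply (Rmult_le_reg_r (lam * lam * u * (2 * m))); [nra|].
        replace (80 / (lam * lam * u) * (lam * lam * u * (2 * m))) with (160 * m) by (field; lra).
        replace (1 / (2 * m) * (lam * lam * u * (2 * m))) with (lam * lam * u) by (field; lra). lra.
    + apply (grid_cover _ (E lam) X _ (- (2 * u))); try lra; try nra.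
      * intros z Hz. apply (tame_box_image lam M0 m l); try easy. fold u. nra.
      * intros x y Hx. unfold S0.
        apply (covered_pullback lam X _ _ _ (tame_box lam M0 x y)); try lra.
        -- intros z ((Tz & _) & HR & HI). split; [|lra]. split; [now apply tame_E|easy].
        -- intros z w [Bz _] [Bw _]. now apply (tame_box_strip lam M0 m l).
        -- apply (covered_mono _ (tame_box lam M0 x y) (1 / 4 * p) _ (320 / lam / x * p)); [auto|lra| |].
           ++ apply Rmult_le_compat_r; [lra|]. unfold Rdiv at 1 3. apply Rmult_le_compat_l.
              ** left. apply Rdiv_lt_0_compat; lra.
              ** apply Rinv_le_contravar; lra.
           ++ apply IH. lra.
Qed.

(** ** Null sets *)

(** Keeping the pieces separate makes countable unions a mere reindexing; the summation over pieces
    is postponed to [Hnull_of_sigma_null]. *)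
Definition sigma_null (A : C -> Prop) : Prop := exists B : nat -> C -> Prop,
  (forall z, A z -> exists i, B i z) /\
  forall i eta S, 0 < eta -> 0 < S -> covered (B i) eta S.

Lemma sigma_null_subset (A B : C -> Prop) : (forall z, A z -> B z) -> sigma_null B -> sigma_null A.
Proof. intros H (D & H1 & H2). exists D. split; auto. Qed.

Lemma sigma_null_union (A : nat -> C -> Prop) : (forall i, sigma_null (A i)) ->
  sigma_null (fun z => exists i, A i z).
Proof.
  intros H.
  destruct (functional_choice (fun i (B : nat -> C -> Prop) => (forall z, A i z -> exists j, B j z) /\
    forall j eta S, 0 < eta -> 0 < S -> covered (B j) eta S) H) as [B HB].
  exists (fun k => B (fst (of_nat k)) (snd (of_nat k))). split.
  - intros z [i Hz]. destruct (proj1 (HB i) z Hz) as [j Hj]. exists (to_nat (i, j)).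
    now rewrite cancel_of_to.
  - intros k. apply (HB (fst (of_nat k))).
Qed.

Lemma sigma_null_union_Z (A : Z -> C -> Prop) : (forall k, sigma_null (A k)) ->
  sigma_null (fun z => exists k, A k z).
Proof.
  intros H.
  apply (sigma_null_subset _ (fun z => exists i, exists j, A (Z.of_nat i - Z.of_nat j)%Z z)).
  - intros z [k Hk]. exists (Z.to_nat k), (Z.to_nat (- k)).
    now replace (Z.of_nat (Z.to_nat k) - Z.of_nat (Z.to_nat (- k)))%Z with k by lia.
  - apply sigma_null_union. intros i. apply sigma_null_union. intros j. apply H.
Qed.

Lemma sigma_null_pullback (lam : R) (k : Z) (A : C -> Prop) : 0 < lam -> sigma_null A ->
  sigma_null (fun z => A (E lam z) /\ strip z = k /\ 1 <= Re (E lam z)).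
Proof.
  intros Hl (B & HB & Hcov).
  exists (fun i z => B i (E lam z) /\ strip z = k /\ 1 <= Re (E lam z)). split.
  - intros z (Hz & Hk & HR). destruct (HB _ Hz) as [i Hi]. now exists i.
  (* Capping [eta] at 1/2 meets the requirement eta < 1 of [covered_pullback], used here with
     expansion factor 1. *)
  - intros i eta S He HS. pose proof (Rmin_l eta (1 / 2)). pose proof (Rmin_r eta (1 / 2)).
    apply (covered_mono _ (fun z => B i (E lam z) /\ strip z = k /\ 1 <= Re (E lam z))
      (Rmin eta (1 / 2) / 1) _ (S / 1)); [auto|lra|lra|].
    apply (covered_pullback lam 1 _ _ _ (B i)); try lra; try tauto.
    + intros z w (_ & H1 & _) (_ & H2 & _). congruence.
    + apply Hcov; [|easy]. apply Rmin_glb_lt; lra.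
Qed.

Lemma tame_box_small (lam m l eta S : R) : 0 < lam -> lam < 1 -> 2560 / (lam * lam) <= m ->
  0 < eta -> 0 < S -> covered (tame_box lam (2560 / (lam * lam)) m l) eta S.
Proof.
  intros Hl Hl1 Hm He HS.
  assert (0 < m). { apply Rlt_le_trans with (2 := Hm). apply Rdiv_lt_0_compat; nra. }
  assert (HK : 0 <= 320 / lam / m) by (left; repeat apply Rdiv_lt_0_compat; lra).
  destruct (pow_small (1 / 2) (1 / 4) eta) as [N1 H1]; try lra.
  destruct (pow_small (1 / 2) (320 / lam / m) S) as [N2 H2]; try lra.
  specialize (H1 (N1 + N2)%nat ltac:(lia)). specialize (H2 (N1 + N2)%nat ltac:(lia)).
  apply (covered_mono _ (tame_box lam (2560 / (lam * lam)) m l) (1 / 4 * (1 / 2) ^ (N1 + N2)) _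
    (320 / lam / m * (1 / 2) ^ (N1 + N2))); [auto|lra|lra|].
  now apply tame_box_covered.
Qed.

Lemma tame_sigma_null (lam : R) : 0 < lam -> lam < 1 -> sigma_null (tame lam (2560 / (lam * lam))).
Proof.
  intros Hl Hl1. set (M0 := 2560 / (lam * lam)).
  apply (sigma_null_subset _ (fun z => exists i, exists l : Z, tame_box lam M0 (M0 + INR i) (IZR l) z)).
  - intros z Tz. pose proof (proj1 (Tz 0%nat) : M0 <= Re z) as HR.
    destruct (archimed (Re z - M0)) as [H1 H2]. destruct (archimed (Im z)) as [H3 H4].
    exists (Z.to_nat (up (Re z - M0) - 1)), (up (Im z) - 1)%Z.
    assert (0 <= up (Re z - M0) - 1)%Z by (assert (0 < up (Re z - M0))%Z by (apply lt_IZR; lra); lia).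
    split; [easy|]. rewrite INR_IZR_INZ, Z2Nat.id, !minus_IZR by easy. lra.
  - apply sigma_null_union. intros i. apply sigma_null_union_Z. intros l.
    exists (fun _ => tame_box lam M0 (M0 + INR i) (IZR l)). split; [now exists 0%nat|].
    intros _ eta S He HS. apply tame_box_small; try assumption. fold M0. pose proof (pos_INR i). lra.
Qed.

(** Induction on the entry time N, removing one application of E per step and splitting by strips
    each time. *)
Lemma eventually_tame_sigma_null (lam b : R) : 0 < lam -> lam < 1 -> 1 < b ->
  sigma_null (fun z => orbit_ge lam b z /\ exists N, tame lam (2560 / (lam * lam)) (Eiter lam N z)).
Proof.
  intros Hl Hl1 Hb. set (M0 := 2560 / (lam * lam)).
  apply (sigma_null_subset _ (fun z => exists N, orbit_ge lam b z /\ tame lam M0 (Eiter lam N z))).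
  { intros z (Hz & N & HN). now exists N. }
  apply sigma_null_union. intros N. induction N as [|N IH].
  - apply (sigma_null_subset _ (tame lam M0)); [now intros z [_ Hz]|]. now apply tame_sigma_null.
  - apply (sigma_null_subset _ (fun z => exists k : Z,
      (orbit_ge lam b (E lam z) /\ tame lam M0 (Eiter lam N (E lam z))) /\
      strip z = k /\ 1 <= Re (E lam z))).
    + intros z [Hz Tz]. exists (strip z). rewrite <- Eiter_succ.
      pose proof (Hz 1%nat : b <= Re (E lam z)). pose proof (orbit_ge_E _ _ _ Hz).
      split; [split; [easy | exact Tz] | split; [easy | lra]].
    + apply sigma_null_union_Z. intros k. exact (sigma_null_pullback lam k _ Hl IH).
Qed.

(** * From finite covers to the gauge measure *)

Lemma hgauge_nonneg (s t : R) : 0 <= hgauge s t.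
Proof.
  unfold hgauge. destruct (Rle_dec t 0); [lra|].
  apply Rmult_le_pos; [lra|]. left. apply Rinv_0_lt_compat. apply exp_pos.
Qed.

(** d <= 1/4 < 1/e makes ln (1/d) at least 1, so raising it to the power s does not decrease it. *)
Lemma hgauge_le_log_gauge (s d : R) : 1 < s -> 0 < d -> d <= 1 / 4 -> hgauge s d <= log_gauge d.
Proof.
  intros Hs H0 H1. unfold hgauge, log_gauge. destruct (Rle_dec d 0); [lra|].
  assert (Hln : 1 <= ln (/ d)).
  { rewrite <- (ln_exp 1). apply ln_le_mono; [apply exp_pos|]. pose proof exp_le_3.
    apply Rle_trans with 4; [lra|]. replace 4 with (/ (1 / 4)) by field. now apply Rinv_le_contravar. }
  apply Rmult_le_compat_l; [lra|]. apply Rinv_le_contravar; [lra|].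
  rewrite <- (Rpower_1 (ln (/ d))) at 1 by lra.
  destruct (Req_dec (ln (/ d)) 1) as [He|Hn].
  - rewrite He. unfold Rpower. rewrite ln_1, !Rmult_0_r. lra.
  - apply Rle_Rpower; lra.
Qed.

Lemma sum_nth_le (l : list R) (N : nat) : (forall x, In x l -> 0 <= x) ->
  sum_f_R0 (fun k => nth k l 0) N <= fold_right Rplus 0 l.
Proof.
  revert N. induction l as [|x l IH]; intros N Hl.
  - right. cbn [fold_right]. induction N as [|N IHN]; cbn in *; [easy|]. rewrite IHN. ring.
  - assert (Hx : 0 <= x) by (apply Hl; now left).
    assert (Hl' : forall y, In y l -> 0 <= y) by (intros y Hy; apply Hl; now right).
    assert (H0 : 0 <= fold_right Rplus 0 l).
    { clear IH Hl. induction l as [|y l IH]; cbn; [lra|].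
      pose proof (Hl' y (or_introl eq_refl)). specialize (IH (fun w Hw => Hl' w (or_intror Hw))). lra. }
    destruct N as [|N]; [cbn; lra|].
    rewrite decomp_sum by lia. cbn [pred nth fold_right]. specialize (IH N Hl'). lra.
Qed.

Lemma nth_concat_prefix {T : Type} (L : nat -> list T) (x : T) (n m k : nat) : (n <= m)%nat ->
  (k < length (concat (map L (seq 0 n))))%nat ->
  nth k (concat (map L (seq 0 m))) x = nth k (concat (map L (seq 0 n))) x.
Proof.
  intros Hnm Hk. replace m with (n + (m - n))%nat by lia.
  rewrite seq_app, map_app, concat_app. now apply app_nth1.
Qed.

(* A countable family of finite covers is concatenated into one sequence; a dummy empty set of
   diameter 0 in each list makes the length of the first n lists at least n. *)
Lemma Hnull_of_sigma_null (s : R) (A : C -> Prop) : 1 < s -> sigma_null A -> Hnull (hgauge s) A.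
Proof.
  intros Hs (B & HB & Hcov) delta eps Hd0 Hd1 He.
  set (eta := Rmin (delta / 2) (1 / 4)).
  assert (Heta : 0 < eta) by (apply Rmin_glb_lt; lra).
  assert (Heta1 : eta <= delta / 2) by apply Rmin_l. assert (Heta2 : eta <= 1 / 4) by apply Rmin_r.
  set (dummy := ((fun _ : C => False), 0)).
  destruct (functional_choice (fun i (l : list ((C -> Prop) * R)) =>
    (forall p, In p l -> 0 <= snd p /\ snd p < delta /\
       forall z w, fst p z -> fst p w -> cdist z w <= snd p) /\
    (forall z, B i z -> exists p, In p l /\ fst p z) /\
    fold_right Rplus 0 (map (fun p => hgauge s (snd p)) l) <= eps * (1 / 2) ^ (S i) /\
    (1 <= length l)%nat)) as [L HL].
  { intros i. pose proof (pow_lt (1 / 2) (S i) ltac:(lra)) as Hp.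
    destruct (Hcov i eta (eps * (1 / 2) ^ S i) Heta ltac:(nra)) as (l & H1 & H2 & H3).
    exists (dummy :: l). split; [|split; [|split]].
    - intros p [<-|Hp']; [cbn; repeat split; try lra; easy|].
      destruct (H1 p Hp') as (H4 & H5 & H6). repeat split; auto; lra.
    - intros z Hz. destruct (H2 z Hz) as (p & Hp' & Hpz). exists p. split; [now right|easy].
    - apply Rle_trans with (2 := H3). cbn [map fold_right]. unfold dummy. cbn [snd].
      unfold hgauge at 1. destruct (Rle_dec 0 0); [|lra]. rewrite Rplus_0_l.
      clear H2 H3. induction l as [|p l IH]; [cbn; lra|].
      destruct (H1 p (or_introl eq_refl)) as (H4 & H5 & _).
      specialize (IH (fun q Hq => H1 q (or_intror Hq))).
      pose proof (hgauge_le_log_gauge s (snd p) Hs H4 ltac:(lra)).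
      unfold weight in *. cbn [map fold_right] in *. lra.
    - cbn. lia. }
  set (flat := fun n => concat (map L (seq 0 n))).
  assert (Hlen : forall n, (n <= length (flat n))%nat).
  { intros n. unfold flat. induction n as [|n IH]; [cbn; lia|].
    rewrite seq_S, map_app, concat_app, length_app. cbn [map concat]. rewrite app_nil_r.
    destruct (HL (0 + n)%nat) as (_ & _ & _ & H). lia. }
  assert (Hin : forall n p, In p (flat n) -> 0 <= snd p /\ snd p < delta /\
       forall z w, fst p z -> fst p w -> cdist z w <= snd p).
  { intros n p Hp. unfold flat in Hp. apply in_concat in Hp. destruct Hp as (l & Hl & Hp).
    apply in_map_iff in Hl. destruct Hl as (i & <- & _). now apply (HL i). }
  (* [flat (S k)] has at least k + 1 entries, so the default is never returned; longer
     concatenations agree at position k by [nth_concat_prefix]. *)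
  set (item := fun k => nth k (flat (S k)) dummy).
  assert (Hitem : forall k, In (item k) (flat (S k))).
  { intros k. apply nth_In. specialize (Hlen (S k)). lia. }
  exists (fun k => fst (item k)), (fun k => snd (item k)).
  split; [|split; [|split]].
  - intros k. destruct (Hin _ _ (Hitem k)) as (H1 & H2 & _). easy.
  - intros k. now apply (Hin _ _ (Hitem k)).
  - intros z Hz. destruct (HB z Hz) as [i Hi]. destruct (proj1 (proj2 (HL i)) z Hi) as (p & Hp & Hpz).
    assert (Hpf : In p (flat (S i))).
    { apply in_concat. exists (L i). split; [|easy]. apply in_map, in_seq. lia. }
    destruct (In_nth _ _ dummy Hpf) as (k & Hk & <-). exists k.
    assert (Heq : item k = nth k (flat (S i)) dummy).
    { unfold item, flat. destruct (Nat.le_ge_cases (S i) (S k)) as [Hik|Hik].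
      - now apply nth_concat_prefix.
      - symmetry. apply nth_concat_prefix; [easy|]. specialize (Hlen (S k)). unfold flat in Hlen. lia. }
    now rewrite Heq.
  - intros N.
    (* List i costs at most eps / 2^(i+1), so the first n lists stay below the partial geometric
       sum. *)
    assert (Hsum : forall n, fold_right Rplus 0 (map (fun p => hgauge s (snd p)) (flat n)) <=
                             eps * (1 - (1 / 2) ^ n)).
    { assert (Happ : forall l l' : list R, fold_right Rplus 0 (l ++ l') = fold_right Rplus 0 l + fold_right Rplus 0 l').
      { induction l as [|x l IH]; intros l'; cbn; [ring|]. rewrite IH. ring. }
      unfold flat. induction n as [|n IH]; [cbn; lra|].
      rewrite seq_S, map_app, concat_app, map_app, Happ. cbn [map concat]. rewrite app_nil_r.
      destruct (HL (0 + n)%nat) as (_ & _ & H & _). cbn [plus pow] in *. lra. }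
    apply Rle_trans with (sum_f_R0 (fun k => nth k (map (fun p => hgauge s (snd p)) (flat (S N))) 0) N).
    + right. apply sum_eq. intros k Hk.
      replace (item k) with (nth k (flat (S N)) dummy).
      * rewrite <- (map_nth (fun p => hgauge s (snd p))). apply nth_indep.
        rewrite length_map. specialize (Hlen (S N)). lia.
      * unfold item, flat. apply nth_concat_prefix; [lia|]. specialize (Hlen (S k)). unfold flat in Hlen. lia.
    + eapply Rle_trans; [apply sum_nth_le|].
      * intros x Hx. apply in_map_iff in Hx. destruct Hx as (p & <- & _). apply hgauge_nonneg.
      * eapply Rle_trans; [apply Hsum|]. pose proof (pow_lt (1 / 2) (S N) ltac:(lra)). nra.
Qed.

Theorem theorem1p1 (lam s : R) :
  0 < lam -> lam < exp (-1) -> 1 < s ->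
  Hnull (hgauge s) (fun z => Julia lam z /\ ~ endpoint lam z).
Proof.
  intros Hl Hl1 Hs.
  destruct (fixed_points lam Hl Hl1) as (a & b & Ha0 & Ha1 & Hb1 & Ha & Hb).
  assert (Hlt : lam < 1).
  { apply Rlt_le_trans with (1 := Hl1). rewrite <- exp_0. apply exp_le_mono. lra. }
  apply Hnull_of_sigma_null; [easy|].
  apply (sigma_null_subset _ _) with (2 := eventually_tame_sigma_null lam b Hl Hlt Hb1).
  intros z [HJ Hend].
  assert (Hz : orbit_ge lam b z) by (intros n; now apply (Julia_Re_ge lam a b)).
  destruct (lower_companion lam a b z) as (c & Hc & Hsame & Hfar); try assumption.
  split; [easy|]. now apply (eventually_tame lam b _ z c).
Qed.
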